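(* Let $(x_n)$ be a basic sequence in a real Banach space $X$ with $\inf_n\|x_n\|>0$, and let $E\subseteq X^*$ be an isomorphically precisely norming set for $X$ such that \[ \sum_n |x^*(x_{n+1}-x_n)|<\infty \quad\text{for all } x^*\in E. \] Then there exists a subsequence of $(x_n)$ whose closed linear span is an isomorphically polyhedral Banach space.
   Context: A set $E \subseteq X^*$ is called isomorphically precisely norming for a Banach space $(X,\|\cdot\|)$ if there exists $C \ge 1$ such that (a) $E \subseteq C\cdot Ba(X^* )$ (where $Ba(X^* )$ is the closed unit ball of $X^*$); (b) $\frac{1}{C}\|x\| \le \sup_{e\in E}|e(x)|$ for all $x \in X$; and (c) for every $x\in X$ there is $e_0 \in E$ with $|e_0(x)| = \sup_{e\in E}|e(x)|$. An infinite dimensional Banach space is polyhedral if the closed unit ball of each of its finite dimensional subspaces has finitely many extreme points; it is isomorphically polyhedral if it is polyhedral under some equivalent norm. A sequence is basic if it is a Schauder basis of its closed linear span. *)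

(* Defs.v *)
From HB Require Import structures.
From mathcomp Require Import all_boot all_order all_algebra.
From mathcomp Require Import all_classical all_reals all_analysis.
Set Implicit Arguments. Unset Strict Implicit. Unset Printing Implicit Defensive.
Import Order.TTheory GRing.Theory Num.Theory.
Import numFieldNormedType.Exports.
Local Open Scope classical_set_scope.
Local Open Scope ring_scope.

Section BanachDefs.
Context {R : realType} {X : normedModType R}.

Definition dual_elem (e : X -> R) : Prop :=
  (forall (a : R) (u v : X), e (a *: u + v) = a * e u + e v) /\ continuous e.

(* Isomorphically precisely norming set (conditions (a),(b),(c));
   the requirement E ⊆ X^* is stated separately via [dual_elem]. *)
Definition iso_precisely_norming (E : set (X -> R)) : Prop :=
  exists C : R, 1 <= C /\
    (forall e, E e -> forall x : X, `|e x| <= C * `|x|) /\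
    (forall x : X, `|x| / C <= sup [set `|e x| | e in E]) /\
    (forall x : X, exists2 e0, E e0 & `|e0 x| = sup [set `|e x| | e in E]).

Definition lin_span (S : set X) : set X :=
  [set y | exists (n : nat) (c : 'I_n -> R) (v : 'I_n -> X),
      (forall i, S (v i)) /\ y = \sum_(i < n) c i *: v i].

Definition closed_span (S : set X) : set X := closure (lin_span S).

Definition basic_seq (x : nat -> X) : Prop :=
  forall y, closed_span (range x) y ->
    exists! a : nat -> R, [series a n *: x n]_n @ \oo --> y.

Definition lin_indep (n : nat) (v : 'I_n -> X) : Prop :=
  forall c : 'I_n -> R, \sum_(i < n) c i *: v i = 0 -> forall i, c i = 0.

Definition infinite_dim (Y : set X) : Prop :=
  forall n : nat, exists v : 'I_n -> X, (forall i, Y (v i)) /\ lin_indep v.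

Definition equiv_norm_on (Y : set X) (N : X -> R) : Prop :=
  (forall y, Y y -> 0 <= N y) /\
  (forall y, Y y -> N y = 0 -> y = 0) /\
  (forall (a : R) y, Y y -> N (a *: y) = `|a| * N y) /\
  (forall y z, Y y -> Y z -> N (y + z) <= N y + N z) /\
  (exists a b : R, 0 < a /\ 0 < b /\
     forall y, Y y -> a * `|y| <= N y /\ N y <= b * `|y|).

Definition extreme_points (K : set X) : set X :=
  [set y | K y /\ forall (a b : X) (t : R), K a -> K b -> 0 < t < 1 ->
      y = t *: a + (1 - t) *: b -> a = b].

(* Y (with norm N) is polyhedral: infinite dimensional and the closed unit
   ball of every finite dimensional subspace has finitely many extreme points.
   Finite dimensional subspaces of Y are the spans of finite families in Y. *)
Definition polyhedral_with (Y : set X) (N : X -> R) : Prop :=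
  infinite_dim Y /\
  forall (n : nat) (v : 'I_n -> X), (forall i, Y (v i)) ->
    finite_set (extreme_points [set y | lin_span (range v) y /\ N y <= 1]).

Definition iso_polyhedral (Y : set X) : Prop :=
  exists N : X -> R, equiv_norm_on Y N /\ polyhedral_with Y N.

End BanachDefs.

(* Main.v *)
Require Import Defs.
From HB Require Import structures.
From mathcomp Require Import all_boot all_order all_algebra.
From mathcomp Require Import all_classical all_reals all_analysis.
From mathcomp Require Import ring lra.
Import Order.TTheory GRing.Theory Num.Theory.
Import numFieldNormedType.Exports.
Local Open Scope classical_set_scope.
Local Open Scope ring_scope.

(** If [u_j], [b_j] is an expansion system of [Y] with bounded coordinates
    [b_j y -> 0] and [sum_j |e u_j| < oo] for all [e] in [E], put on [Y] the norm
      [N y = sup_m (1 + 1/(m+1)) (max_c |sum_(i<m) c_i b_i y| + |b_m y|)],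
    where [c] runs over a finite grid approximating the vectors
    [(e u_0, ..., e u_(m-1))], [e] in [E], up to [1/(m+1)^2].  As [m -> oo] the
    functionals defining [N] do not exceed [q y = sup_E |e y|] in the limit.  On
    the other hand [N y > q y] for [y != 0]: if [e] attains [q y], choose [m] with
    [sum_(j>=m) |e u_j| <= 1] such that [|b_j y|] is maximal over [j >= m] at
    [j = m]; then [|e y| <= |sum_(i<m) e(u_i) b_i y| + |b_m y|].  So locally only
    finitely many functionals matter and finite dimensional balls are polytopes.

    Such a system is found in one of three ways.  If [x] is unbounded, take
    [2^-j x_(phi j)] with [|x_(phi j)| >= 2^j].  If for some [k], [eta > 0], [n]
    and every [N] some [e] in [E] of variation at most [k] along [x] satisfies
    [|e x_i| >= eta] on [[n, N)], Abel summation shows that [sum_i a_i] is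
    dominated by [|sum_i a_i x_i|], and [x_0, x_1 - x_0, x_2 - x_1, ...] works.
    Otherwise [phi] can be chosen so sparse that every [e] of variation at most
    [j] gets below [2^-j] between [phi j] and [phi (j+1)], which makes
    [sum_j |e x_(phi j)|] finite. *)

(** * Subspaces and finite-dimensional spans *)

Section Subspaces.
Context {R : realType} {X : normedModType R}.
Implicit Types (Y : set X) (f : X -> R).

Definition linear_subspace Y : Prop :=
  Y 0 /\ forall (a : R) u v, Y u -> Y v -> Y (a *: u + v).

Definition linear_on Y f : Prop :=
  forall (a : R) u v, Y u -> Y v -> f (a *: u + v) = a * f u + f v.

Lemma linear_subspaceZ Y a u : linear_subspace Y -> Y u -> Y (a *: u).
Proof. by move=> [Y0 YL] Yu; rewrite -[_ *: _]addr0; exact: YL. Qed.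

Lemma linear_subspaceD Y u v : linear_subspace Y -> Y u -> Y v -> Y (u + v).
Proof. by move=> [Y0 YL] Yu Yv; rewrite -[u]scale1r; exact: YL. Qed.

Lemma linear_subspaceB Y u v : linear_subspace Y -> Y u -> Y v -> Y (u - v).
Proof.
by move=> [Y0 YL] Yu Yv; rewrite addrC -scaleN1r; exact: YL.
Qed.

Lemma linear_subspace_sum Y I (r : seq I) (v : I -> X) :
  linear_subspace Y -> (forall i, Y (v i)) -> Y (\sum_(i <- r) v i).
Proof.
move=> YS Yv; elim/big_ind: _ => //; first exact: (proj1 YS).
by move=> ? ?; exact: linear_subspaceD.
Qed.

Lemma linear_on0 Y f : linear_subspace Y -> linear_on Y f -> f 0 = 0.
Proof.
move=> [Y0 _] fL; have := fL 1 0 0 Y0 Y0.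
by rewrite scale1r addr0 mul1r => /eqP; rewrite -subr_eq0 opprD addNKr oppr_eq0 => /eqP.
Qed.

Lemma linear_onZ Y f a u :
  linear_subspace Y -> linear_on Y f -> Y u -> f (a *: u) = a * f u.
Proof.
move=> YS fL Yu; rewrite -[a *: u]addr0 fL ?(linear_on0 Y f)// ?addr0//.
exact: (proj1 YS).
Qed.

Lemma linear_onD Y f u v :
  linear_on Y f -> Y u -> Y v -> f (u + v) = f u + f v.
Proof. by move=> fL Yu Yv; rewrite -[u]scale1r fL// scale1r mul1r. Qed.

Lemma linear_onB Y f u v :
  linear_on Y f -> Y u -> Y v -> f (u - v) = f u - f v.
Proof.
by move=> fL Yu Yv; rewrite addrC -scaleN1r fL// mulN1r addrC.
Qed.

Lemma linear_on_sum Y f I (r : seq I) (v : I -> X) :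
  linear_subspace Y -> linear_on Y f -> (forall i, Y (v i)) ->
  f (\sum_(i <- r) v i) = \sum_(i <- r) f (v i).
Proof.
move=> YS fL Yv; elim: r => [|i r IHr]; first by rewrite !big_nil (linear_on0 Y).
by rewrite !big_cons (linear_onD Y)// ?IHr//; exact: linear_subspace_sum.
Qed.

Lemma linear_on_lincomb Y I (r : seq I) (g : I -> X -> R) (c : I -> R) :
  (forall i, linear_on Y (g i)) ->
  linear_on Y (fun y => \sum_(i <- r) c i * g i y).
Proof.
move=> gL a u v Yu Yv; rewrite mulr_sumr -big_split/=; apply: eq_bigr => i _.
by rewrite gL//; ring.
Qed.

Lemma linear_subspace_lin_span (S : set X) : linear_subspace (lin_span S).
Proof.
split.
  by exists 0%N, (fun=> 0), (fun=> 0); split; [case|rewrite big_ord0].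
move=> a _ _ [n [c [v [Sv ->]]]] [m [d [w [Sw ->]]]].
exists (n + m)%N,
  (fun i : 'I_(n + m) => match fintype.split i with inl j => a * c j | inr j => d j end),
  (fun i : 'I_(n + m) => match fintype.split i with inl j => v j | inr j => w j end).
split; first by move=> i; case: (fintype.split i).
rewrite big_split_ord/= scaler_sumr; congr (_ + _); apply: eq_bigr => i _.
  by rewrite (unsplitK (inl i)) scalerA.
by rewrite (unsplitK (inr i)).
Qed.

Lemma sub_lin_span (S : set X) : S `<=` lin_span S.
Proof.
by move=> y Sy; exists 1%N, (fun=> 1), (fun=> y); rewrite big_ord1 scale1r.
Qed.

Lemma lin_span_min (S Y : set X) :
  linear_subspace Y -> S `<=` Y -> lin_span S `<=` Y.
Proof.
move=> YS SY _ [n [c [v [Sv ->]]]]; apply: linear_subspace_sum => // i.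
by apply: linear_subspaceZ => //; exact: SY.
Qed.

Lemma lin_span_range n (v : 'I_n -> X) y :
  lin_span (range v) y <-> exists c : 'rV[R]_n, y = \sum_i c ord0 i *: v i.
Proof.
split; last first.
  move=> [c ->]; exists n, (fun i => c ord0 i), v; split => // i.
pose Z := [set y | exists c : 'rV[R]_n, y = \sum_i c ord0 i *: v i].
suff : lin_span (range v) `<=` Z by apply.
apply: lin_span_min.
  split.
    by exists 0; rewrite big1// => i _; rewrite mxE scale0r.
  move=> a _ _ [c ->] [d ->]; exists (a *: c + d).
  rewrite scaler_sumr -big_split/=; apply: eq_bigr => i _.
  by rewrite !mxE scalerDl scalerA.
move=> _ [i _ <-]; exists (delta_mx ord0 i); rewrite (bigD1 i)//= mxE !eqxx.
rewrite scale1r big1 ?addr0// => j ji; rewrite mxE eqxx (negPf ji) scale0r//.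
Qed.

(** A vector with nonzero coefficient in a nontrivial relation lies in the span of the others and
    can be discarded. Selecting from [v] itself keeps the new family inside any set containing
    [v]. *)
Lemma exists_lin_indep n (v : 'I_n -> X) :
  exists (m : nat) (w : 'I_m -> X), lin_indep w /\ range w `<=` range v /\
    lin_span (range w) = lin_span (range v).
Proof.
elim: n v => [|n IHn] v; first by exists 0%N, v; split; [move=> c _ []|split].
have [vI|] := pselect (lin_indep v); first by exists n.+1, v; split; [exact: vI|split].
move=> /existsNP[c] /not_implyP[c0] /existsNP[k] /eqP ck.
have [m [w [wI [wv wE]]]] := IHn (fun i => v (lift k i)).
exists m, w; split => //; split.
  move=> _ [j _ <-]; have [|i _ <-] := wv (w j); first by exists j.
  by exists (lift k i).
rewrite wE; apply/seteqP; split.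
  apply: lin_span_min; first exact: linear_subspace_lin_span.
  by move=> _ [i _ <-]; apply: sub_lin_span; exists (lift k i).
apply: lin_span_min; first exact: linear_subspace_lin_span.
move=> _ [i _ <-]; have [j ->|->] := unliftP k i.
  by apply: sub_lin_span; exists j.
move: c0; rewrite (bigD1_ord k)//= => /eqP; rewrite addr_eq0 => /eqP h.
rewrite -[v k]scale1r -(mulVf ck) -scalerA h -sumrN scaler_sumr.
apply: linear_subspace_sum; first exact: linear_subspace_lin_span.
move=> j; rewrite -scaleNr scalerA; apply: linear_subspaceZ; first exact: linear_subspace_lin_span.
by apply: sub_lin_span; exists j.
Qed.

Lemma continuous_lincomb n (v : 'I_n -> X) :
  continuous (fun c : 'rV[R]_n => \sum_i c ord0 i *: v i).
Proof.
move=> c; apply: cvg_big => [| |i _]; [exact: add_continuous|exact: (@nbhs_filter _ c)|].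
by by have /(cvgZr_tmp (a := v i)) := @coord_continuous R 1 n ord0 i c.
Qed.

(** The norm of the combination attains its minimum on the compact unit sphere of coefficients;
    independence makes it positive, and homogeneity spreads the bound to all [c]. *)
Lemma lin_indep_bound n (v : 'I_n -> X) : lin_indep v ->
  exists2 k : R, 0 < k &
    forall c : 'rV[R]_n, k * `|c| <= `|\sum_i c ord0 i *: v i|.
Proof.
move=> vI; pose S := [set c : 'rV[R]_n | `|c| = 1].
pose L (c : 'rV[R]_n) := \sum_i c ord0 i *: v i.
have LZ a c : L (a *: c) = a *: L c.
  by rewrite /L scaler_sumr; apply: eq_bigr => i _; rewrite mxE scalerA.
have [[s Ss]|S0] := pselect (S !=set0); last first.
  (* An empty sphere leaves only [c = 0], so any constant will do. *)
  exists 1 => // c; rewrite mul1r.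
  have [->|c0] := eqVneq c 0; first by rewrite normr0.
  exfalso; apply: S0; exists (`|c|^-1 *: c).
  by rewrite /S/= normrZ gtr0_norm ?invr_gt0 ?normr_gt0// mulVf// normr_eq0.
have cS : compact S.
  apply: bounded_closed_compact.
    exists 1; split => // M M1 c /= ->; exact: ltW.
  rewrite (_ : S = (fun c => `|c|) @^-1` [set 1])//.
  by apply: preimage_closed; [move=> c _; exact: norm_continuous|exact: closed_eq].
have cL : {within S, continuous (fun c => `|L c|)}.
  apply: continuous_subspaceT => c.
  by apply: continuous_comp; [exact: continuous_lincomb|exact: norm_continuous].
have [|c cSc cmin] := EVT_min_rV _ cS cL; first by exists s.
move: cSc; rewrite inE => cSc.
have k0 : 0 < `|L c|.
  rewrite normr_gt0; apply/eqP => Lc0.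
  have c0 : c = 0 by apply/rowP => i; rewrite mxE; exact: (vI (c ord0)).
  by move: cSc; rewrite /S/= c0 normr0 => /esym/eqP; rewrite oner_eq0.
exists `|L c| => // d; have [->|d0] := eqVneq d 0; first by rewrite normr0 mulr0.
rewrite -/(L d).
have nd0 : 0 < `|d| by rewrite normr_gt0.
have := cmin (`|d|^-1 *: d); rewrite inE /S/= normrZ ger0_norm ?invr_ge0// mulVf ?gt_eqF//.
move=> /(_ erefl); rewrite LZ normrZ ger0_norm ?invr_ge0//.
by rewrite ler_pdivlMl// mulrC.
Qed.

End Subspaces.

(** * Norms given by locally finite families of functionals *)

Lemma exists_common_pos {R : realType} {T : eqType} (s : seq T)
    (P : T -> R -> Prop) :
  (forall x t u, 0 < u <= t -> P x t -> P x u) ->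
  (forall x, x \in s -> exists2 t : R, 0 < t & P x t) ->
  exists2 t : R, 0 < t & forall x, x \in s -> P x t.
Proof.
move=> Pmono; elim: s => [|x s IHs] Ps; first by exists 1.
have [t t0 Pt] : exists2 t : R, 0 < t & forall x, x \in s -> P x t.
  by apply: IHs => y ys; apply: Ps; rewrite inE ys orbT.
have [u u0 Pu] := Ps x (mem_head _ _).
exists (Num.min t u); first by rewrite lt_min t0.
move=> y; rewrite inE => /orP[/eqP ->|ys].
  by apply: Pmono Pu; rewrite lt_min t0 u0 ge_min lexx orbT.
by apply: Pmono (Pt y ys); rewrite lt_min t0 u0 ge_min lexx.
Qed.

Section FamilyNorm.
Context {R : realType} {X : normedModType R}.
Context (Y : set X) (B : set (X -> R)) (M : R).
Context (YS : linear_subspace Y) (B0 : B !=set0).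
Context (BL : forall f, B f -> linear_on Y f) (M0 : 0 < M).
Context (BM : forall f y, B f -> Y y -> `|f y| <= M * `|y|).

Definition family_norm (y : X) : R := sup [set `|f y| | f in B].

Lemma family_norm_ge f y : B f -> Y y -> `|f y| <= family_norm y.
Proof.
move=> Bf Yy; apply: ub_le_sup; last by exists f.
by exists (M * `|y|) => _ [g Bg <-]; exact: BM.
Qed.

Lemma family_norm_le y r : (forall f, B f -> `|f y| <= r) -> family_norm y <= r.
Proof.
move=> Br; apply: ge_sup; first by have [f Bf] := B0; exists `|f y|, f.
by move=> _ [f Bf <-]; exact: Br.
Qed.

Lemma family_norm_ge0 y : Y y -> 0 <= family_norm y.
Proof.
by move=> Yy; have [f Bf] := B0; apply: le_trans (family_norm_ge f y Bf Yy).
Qed.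

Lemma family_norm_triangle u v : Y u -> Y v ->
  family_norm (u + v) <= family_norm u + family_norm v.
Proof.
move=> Yu Yv; apply: family_norm_le => f Bf; rewrite (linear_onD Y)//; last exact: BL.
by apply: le_trans (ler_normD _ _) _; apply: lerD; exact: family_norm_ge.
Qed.

Lemma family_normZ a u : Y u -> family_norm (a *: u) = `|a| * family_norm u.
Proof.
move=> Yu; have le b w : Y w -> family_norm (b *: w) <= `|b| * family_norm w.
  move=> Yw; apply: family_norm_le => f Bf.
  rewrite (linear_onZ Y)//; last exact: BL.
  by rewrite normrM ler_wpM2l// family_norm_ge.
apply/eqP; rewrite eq_le le//=.
have [->|a0] := eqVneq a 0.
  by rewrite normr0 mul0r family_norm_ge0// scale0r; exact: (proj1 YS).
have := le a^-1 (a *: u) (linear_subspaceZ Y a u YS Yu).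
rewrite scalerA mulVf// scale1r normfV.
by rewrite ler_pdivlMl ?normr_gt0.
Qed.

Lemma family_norm_leM y : Y y -> family_norm y <= M * `|y|.
Proof. by move=> Yy; apply: family_norm_le => f Bf; exact: BM. Qed.

Lemma family_norm_equiv k : 0 < k ->
  (forall y, Y y -> k * `|y| <= family_norm y) -> equiv_norm_on Y family_norm.
Proof.
move=> k0 kN; split; first by move=> y; exact: family_norm_ge0.
split.
  move=> y Yy Ny0; apply/eqP; rewrite -normr_le0.
  by have := kN y Yy; rewrite Ny0 pmulr_rle0.
split; first by move=> a y; exact: family_normZ.
split; first by move=> y z; exact: family_norm_triangle.
exists k, M; do 2![split=> //] => y Yy.
by split; [exact: kN|exact: family_norm_leM].
Qed.

Context (k : R) (k0 : 0 < k) (kN : forall y, Y y -> k * `|y| <= family_norm y).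
(** Local finiteness: functionals outside the finite set [J] stay below the norm of [y] by a uniform
    margin, hence also at points near [y]. *)
Context (gap : forall y, Y y -> y != 0 -> exists (rho : R) (J : set (X -> R)),
  [/\ rho < family_norm y, finite_set J &
      forall f, B f -> ~ J f -> `|f y| <= rho]).

(** * Extreme points of balls of subspaces *)

Section Ball.
Context (F : set X) (FS : linear_subspace F) (FY : F `<=` Y).
Let K := [set y | F y /\ family_norm y <= 1].

(** Near [y] only the functionals of a finite set [J] can take the values 1 and -1 on the ball. An
    extreme point is determined by which of them do: two extreme points with the same pattern differ
    by a direction killed by all active functionals, along which one could move both ways inside the
    ball. *)
Lemma finite_extreme_points_near y : F y ->
  exists2 r, 0 < r &
    finite_set (extreme_points K `&` [set z | `|z - y| < r]).
Proof.
move=> Fy; have Yy := FY _ Fy.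
have [N1|N1] := ltP 1 (family_norm y).
  (* By [family_norm_leM] the norm still exceeds 1 on this neighbourhood, which therefore misses
     [K]. *)
  exists ((family_norm y - 1) / M); first by rewrite divr_gt0 ?subr_gt0.
  rewrite (_ : _ `&` _ = set0)//; apply/seteqP; split=> // z [[[Fz Nz] _]].
  rewrite /= ltr_pdivlMr// mulrC => zy.
  have Yzy : Y (y - z) by apply: linear_subspaceB => //; exact: FY.
  have := family_norm_triangle (y - z) z Yzy (FY _ Fz); rewrite subrK.
  by have := family_norm_leM _ Yzy; rewrite distrC; lra.
have [rho [J [rho1 Jfin Jrho]]] : exists (rho : R) (J : set (X -> R)),
    [/\ rho < 1, finite_set J & forall f, B f -> ~ J f -> `|f y| <= rho].
  have [y0|/gap] := eqVneq y 0.
    exists 0, set0; split=> // f Bf _.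
    by rewrite y0 (linear_on0 Y)// ?normr0//; exact: BL.
  by move=> /(_ Yy)[rho [J [rhoN Jfin Jrho]]]; exists rho, J; split=> //; lra.
have /finite_seqP[s sJ] := Jfin.
(* Within this radius functionals outside [J] move by less than [(1 - rho) / 2], so they stay at
   most [(1 + rho) / 2]. *)
exists ((1 - rho) / 2 / M); first by rewrite !divr_gt0// subr_gt0.
pose pat z : {ffun 'I_(size s) -> bool * bool} :=
  [ffun i => (tnth (in_tuple s) i z == 1, tnth (in_tuple s) i z == -1)].
set A := _ `&` _.
suff patI : {in A &, injective pat}.
  by rewrite -(eq_finite_set (inj_card_eq patI)); exact: finite_finset.
move=> z z'; rewrite !inE => -[[[Fz Nz] zext] zy] [[[Fz' _] _] _] /ffunP patE.
apply/eqP; rewrite eq_sym; apply/negP => /negP zz'.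
pose d := z' - z; have Fd : F d by exact: linear_subspaceB.
have Yz := FY _ Fz; have Yd := FY _ Fd.
have d0 : 0 < `|d| by rewrite normr_gt0 subr_eq0.
have fzy f : B f -> ~ J f -> `|f z| <= (1 + rho) / 2.
  move=> Bf Jf; rewrite -[z](subrK y) (linear_onD Y)//; first last.
  - by apply: linear_subspaceB.
  - exact: BL.
  apply: le_trans (ler_normD _ _) _; have := Jrho f Bf Jf.
  have := BM f (z - y) Bf (linear_subspaceB Y z y YS Yz Yy).
  move: zy; rewrite /= ltr_pdivlMr// => zy; lra.
(* An active functional vanishes on [d] because the patterns agree; an inactive one leaves the slack
   [1 - |f z|]. *)
have [t t0 tJ] : exists2 t : R, 0 < t & forall f, f \in s ->
    (B f -> `|f z| + t * `|f d| <= 1).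
  apply: exists_common_pos => [f t u /andP[u0 ut] h Bf|f fs].
    by apply: le_trans (h Bf); rewrite lerD2l ler_wpM2r.
  have [Bf|] := pselect (B f); last by exists 1.
  have fz1 : `|f z| <= 1 by apply: le_trans Nz; exact: family_norm_ge.
  have [fz|fz] := eqVneq `|f z| 1.
    exists 1 => // _; rewrite mul1r fz gerDl normr_le0 (linear_onB Y)//.
    - rewrite subr_eq0; have i_lt : (index f s < size s)%N by rewrite index_mem.
      have := patE (Ordinal i_lt); rewrite !ffunE !(tnth_nth f)/= nth_index//.
      move=> -[]; move/eqP: fz; rewrite eqr_norml ler01 andbT => /orP[]/eqP->.
        by rewrite eqxx => /esym/eqP ->.
      by rewrite eqxx => _ /esym/eqP ->.
    - exact: BL.
    - exact: FY.
  have fd1 : 0 < `|f d| + 1 by rewrite ltr_wpDl.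
  exists ((1 - `|f z|) / (`|f d| + 1)).
    by rewrite divr_gt0 ?fd1// subr_gt0 lt_neqAle fz.
  move=> _; rewrite -lerBrDl mulrAC ler_pdivrMr//.
  rewrite ler_wpM2l ?subr_ge0// lerDl//.
(* The second bound handles the functionals outside [J], whose slack is at least [(1 - rho) / 2]. *)
pose u := Num.min t ((1 - rho) / 2 / (M * `|d|)).
have u0 : 0 < u by rewrite lt_min t0 !divr_gt0 ?subr_gt0// mulr_gt0.
have Ku (a : R) : `|a| = u -> K (z + a *: d).
  move=> au; have Yad : Y (a *: d) by exact: linear_subspaceZ.
  split; first by apply: linear_subspaceD => //; exact: linear_subspaceZ.
  apply: family_norm_le => f Bf; rewrite (linear_onD Y)//; last exact: BL.
  rewrite (linear_onZ Y)//; last exact: BL.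
  apply: le_trans (ler_normD _ _) _; rewrite normrM au.
  have [Jf|Jf] := pselect (J f).
    have fs : f \in s by move: Jf; rewrite sJ.
    apply: le_trans (tJ f fs Bf).
    by rewrite lerD2l ler_wpM2r// ge_min lexx.
  have : u * (M * `|d|) <= (1 - rho) / 2.
    by rewrite -ler_pdivlMr ?mulr_gt0// ge_min lexx orbT.
  have := fzy f Bf Jf; have := BM f d Bf Yd.
  move=> /(ler_wpM2l (ltW u0)); lra.
(* Now [z] is the midpoint of two distinct points of the ball. *)
have := zext (z + u *: d) (z + (- u) *: d) (1 / 2)
  (Ku u (gtr0_norm u0)) (Ku (- u) _).
rewrite normrN gtr0_norm// => /(_ erefl) h.
have /h : (0 < 1 / 2 :> R) && (1 / 2 < 1 :> R) by apply/andP; split; lra.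
have -> : 1 - 1 / 2 = 1 / 2 :> R by lra.
rewrite -scalerDr addrACA -scalerDl subrr scale0r addr0 -mulr2n -[z *+ 2]scaler_nat.
rewrite scalerA (_ : 1 / 2 * 2%:R = 1 :> R); last by lra.
rewrite scale1r => /(_ erefl) /addrI /eqP; rewrite scaleNr -subr_eq0 opprK.
by move: d0; rewrite normr_gt0 -scalerDl scaler_eq0 => /negPf ->; rewrite orbF gt_eqF// addr_gt0.
Qed.

End Ball.

(** In coordinates with respect to a basis the ball lies in a compact set, and a locally finite
    subset of a compact set is finite. *)
Lemma finite_extreme_points n (v : 'I_n -> X) : (forall i, Y (v i)) ->
  finite_set (extreme_points
    [set y | lin_span (range v) y /\ family_norm y <= 1]).
Proof.
move=> Yv; have [m [w [wI [wv <-]]]] := exists_lin_indep n v.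
have Yw i : Y (w i) by have [|j _ <-] := wv (w i); first by exists i.
set F := lin_span (range w).
have FS : linear_subspace F by exact: linear_subspace_lin_span.
have FY : F `<=` Y by apply: lin_span_min => // _ [i _ <-].
set A := extreme_points _.
pose L (c : 'rV[R]_m) := \sum_i c ord0 i *: w i.
have FL c : F (L c) by apply/lin_span_range; exists c.
have [q q0 qL] := lin_indep_bound m w wI.
have kq0 : 0 < k * q by rewrite mulr_gt0.
have Lball c : family_norm (L c) <= 1 -> `|c| <= (k * q)^-1.
  move=> Nc; rewrite -[_^-1]mul1r ler_pdivlMr// mulrC -mulrA.
  apply: le_trans Nc; apply: le_trans (kN _ (FY _ (FL c))).
  by rewrite ler_wpM2l ?(ltW k0).
pose D := [set c : 'rV[R]_m | `|c| <= (k * q)^-1].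
have cD : compact D.
  apply: bounded_closed_compact.
    by exists (k * q)^-1; split; [exact: num_real|move=> r rM c /= /le_trans->//; exact: ltW].
  rewrite (_ : D = (fun c => `|c|) @^-1` [set x | x <= (k * q)^-1])//.
  by apply: preimage_closed; [move=> c _; exact: norm_continuous|exact: closed_le].
pose A' := L @^-1` A.
suff A'fin : finite_set A'.
  apply: (sub_finite_set _ (finite_image L A'fin)) => y Ay.
  have [[/lin_span_range[c yc] _] _] := Ay.
  by exists c => //; rewrite /A' /= /L -yc.
apply: contrapT => A'inf.
(* Sets containing all but finitely many points of [A']: a proper filter when [A'] is infinite,
   whose cluster point contradicts local finiteness. *)
pose G := [set S : set 'rV[R]_m | finite_set (A' `\` S)].
have GF : ProperFilter G.
  split; first by rewrite /G/= setD0.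
  split.
  - by rewrite /G/= setDT; exact: finite_set0.
  - move=> S T GS GT; rewrite /G/= setDIr; rewrite finite_setU; split; [exact: GS|exact: GT].
  - by move=> S T ST GS; apply: sub_finite_set GS => c [A'c Tc]; split=> // /ST.
have GD : G D.
  rewrite /G/= (_ : _ `\` _ = set0)//.
  by apply/seteqP; split=> // c [[[_ /Lball Dc] _]].
have [c [_ cl]] := cD G GF GD.
have [r r0 rfin] := finite_extreme_points_near F FS FY (L c) (FL c).
pose U := [set b | `|L b - L c| < r].
have nU : nbhs c U.
  have /cvgrPdist_lt/(_ r r0) := continuous_lincomb m w c.
  by apply: filterS => b /=; rewrite distrC.
have GU : G (~` U).
  rewrite /G/= setDE setCK.
  apply: (sub_finite_set (B := L @^-1` (A `&` [set z | `|z - L c| < r]))) => //.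
  apply: finite_preimage rfin => b b' _ _ /eqP; rewrite -subr_eq0 => /eqP bb'.
  apply/eqP; rewrite -subr_eq0 -normr_le0 -(pmulr_rle0 _ q0).
  apply: le_trans (qL _) _; rewrite normr_le0; apply/eqP; apply: etrans bb'; rewrite /L -sumrB.
  by apply: eq_bigr => i _; rewrite !mxE scalerBl.
by have [b []] := cl _ _ GU nU.
Qed.

Lemma polyhedral_family_norm : infinite_dim Y -> polyhedral_with Y family_norm.
Proof. by move=> Yinf; split => // n v; exact: finite_extreme_points. Qed.

End FamilyNorm.

(** * The polyhedral renorming *)

Lemma cvgn_distP {R : realType} {V : normedModType R} (v : nat -> V) (l : V) :
  v @ \oo --> l <->
  forall eps : R, 0 < eps ->
    exists N, forall n, (N <= n)%N -> `|v n - l| < eps.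
Proof.
rewrite cvgrPdistC_lt; split => h eps eps0.
  by have [N _ hN] := h eps eps0; exists N => n /hN.
by have [N hN] := h eps eps0; exists N => // n /hN.
Qed.

(** Rounding each [c i] to the grid of mesh [d], up where [b i] is positive and down elsewhere,
    cannot decrease any term [c i * b i] and moves each coordinate by at most [d]. Grid points far
    from [K] are discarded, so each one kept is a perturbation of an element of [K]. *)
Lemma finite_grid {R : realType} (n : nat) (K : set (nat -> R)) (A d : R) :
  0 < d -> (forall c i, K c -> (i < n)%N -> `|c i| <= A) ->
  exists G : set (nat -> R), [/\ finite_set G,
    forall g, G g -> exists2 c, K c &
      forall i, (i < n)%N -> `|g i - c i| <= d &
    forall c (b : nat -> R), K c -> exists2 g, G g &
      \sum_(0 <= i < n) c i * b i <= \sum_(0 <= i < n) g i * b i].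
Proof.
move=> d0 KA; pose T := (Num.trunc (2 * A / d)).+1.
pose pt (t : n.-tuple 'I_T.+1) (i : nat) : R := - A + d * (nth ord0 t i : nat)%:R.
exists [set g | range pt g /\ exists2 c, K c &
      forall i, (i < n)%N -> `|g i - c i| <= d]; split.
- apply: (sub_finite_set (B := range pt)); first by move=> g [].
  exact/finite_image/finite_finset.
- by move=> g [].
move=> c b Kc.
pose tau i := (Num.trunc ((c i + A) / d) + (0 < b i)%R)%N.
have Ac i : (i < n)%N -> 0 <= (c i + A) / d.
  move=> i_n; apply: divr_ge0; last exact: ltW.
  by have := KA c i Kc i_n; rewrite ler_norml => /andP[]; lra.
have tauT i : (i < n)%N -> (tau i < T.+1)%N.
  move=> i_n; rewrite /tau ltnS /T -[X in (_ <= X)%N]addn1; apply: leq_add; last by case: (0 < b i)%R.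
  rewrite le_truncn// ler_pM2r ?invr_gt0//.
  by have := KA c i Kc i_n; rewrite ler_norml => /andP[_]; lra.
pose t : n.-tuple 'I_T.+1 := [tuple inord (tau i) | i < n].
have ptE i : (i < n)%N -> pt t i = - A + d * (tau i)%:R.
  move=> i_n; rewrite /pt (_ : i = Ordinal i_n :> nat)// nth_mktuple inordK//.
  exact: tauT.
have tr i : (i < n)%N -> (Num.trunc ((c i + A) / d))%:R * d <= c i + A /\
    c i + A < (Num.trunc ((c i + A) / d))%:R * d + d.
  move=> i_n; have /andP[lo hi] := truncn_itv (Ac i i_n); split.
    by rewrite -ler_pdivlMr.
  by move: hi; rewrite ltr_pdivrMr// -natr1 mulrDl mul1r.
exists (pt t).
  split; first by exists t.
  exists c => // i i_n; rewrite ptE// /tau natrD ler_norml.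
  have [lo hi] := tr i i_n.
  by case: (0 < b i); apply/andP; split; rewrite /=; lra.
rewrite !big_nat; apply: ler_sum => i /andP[_ i_n].
rewrite ptE// /tau natrD; have [lo hi] := tr i i_n.
have [bi|bi] := ltP 0 (b i); first by rewrite ler_pM2r//=; lra.
by rewrite ler_wnM2r//=; lra.
Qed.

(** Only finitely many indices reach a given positive value [r p]. The last of them works, since a
    larger value further on would also reach [r p]. *)
Lemma exists_tail_max {R : realType} (r : nat -> R) (m : nat) :
  (forall j, 0 <= r j) -> r @ \oo --> (0 : R) ->
  exists2 p, (m <= p)%N & forall j, (p <= j)%N -> r j <= r p.
Proof.
move=> r0 /cvgn_distP rcvg.
have [[p mp rp]|none] := pselect (exists2 p, (m <= p)%N & 0 < r p); last first.
  exists m => // j mj; apply: le_trans (r0 m); rewrite leNgt; apply/negP => rj.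
  by apply: none; exists j.
have [N rN] := rcvg _ rp.
have ex : exists i, (p <= i)%N && (r p <= r i) by exists p; rewrite leqnn lexx.
have bd i : (p <= i)%N && (r p <= r i) -> (i <= N)%N.
  move=> /andP[_ ri]; rewrite leqNgt; apply/negP => /ltnW /rN.
  by rewrite subr0 ger0_norm// ltNge ri.
have [q /andP[pq rq] qmax] := ex_maxnP ex bd.
exists q => [|j qj]; first exact: leq_trans pq.
rewrite leNgt; apply/negP => rj.
have : (j <= q)%N by apply: qmax; rewrite (leq_trans pq qj)/= (le_trans rq)// ltW.
by move=> jq; move: rj; rewrite (_ : j = q) ?ltxx//; apply/eqP; rewrite eqn_leq jq.
Qed.

Lemma cvgn_norm0 {R : realType} {V : normedModType R} (v : nat -> V) :
  v @ \oo --> (0 : V) -> (fun n => `|v n|) @ \oo --> (0 : R).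
Proof. by move=> /cvg_norm; rewrite normr0. Qed.

(** * The polyhedral norm of an expansion system *)

Section Expansion.
Context {R : realType} {X : normedModType R} (Y : set X) (E : set (X -> R)).
Context (b : nat -> X -> R) (u : nat -> X) (C M : R).
Context (YS : linear_subspace Y) (Yinf : infinite_dim Y).
Context (Edual : forall e, E e -> dual_elem e) (C1 : 1 <= C).
Context (EC : forall e, E e -> forall x, `|e x| <= C * `|x|).
Context (Elow : forall x, `|x| / C <= sup [set `|e x| | e in E]).
Context (Eatt : forall x,
  exists2 e0, E e0 & `|e0 x| = sup [set `|e x| | e in E]).
Context (M0 : 0 < M) (bL : forall i, linear_on Y (b i)).
Context (bM : forall i y, Y y -> `|b i y| <= M * `|y|).
Context (bcvg0 : forall y, Y y -> b ^~ y @ \oo --> (0 : R)).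
Let Q y m : X := \sum_(0 <= i < m) b i y *: u i.
Context (QM : forall y m, Y y -> `|Q y m| <= M * `|y|).
Context (Qcvg : forall y, Y y -> Q y @ \oo --> y).
Context (Eu : forall e, E e -> cvgn [series `|e (u n)|]_n).

Let q x := sup [set `|e x| | e in E].
Let w m : R := 1 + m.+1%:R^-1.
(** The mesh is a square so that the errors in [m.+1] coordinates add up to a factor [m.+1%:R^-1],
    which still tends to 0. *)
Let d m : R := m.+1%:R^-1 ^+ 2.

Let C0 : 0 < C. Proof. exact: lt_le_trans ltr01 C1. Qed.

Let q_ge e x : E e -> `|e x| <= q x.
Proof.
move=> Ee; apply: ub_le_sup; last by exists e.
by exists (C * `|x|) => _ [f Ef <-]; exact: EC.
Qed.

Let E_linear e : E e -> linear_on [set: X] e.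
Proof. by move=> /Edual[eL _] a x y _ _; exact: eL. Qed.

Let setT_subspace : linear_subspace [set: X]. Proof. by []. Qed.

Let E_Q e y m : E e -> e (Q y m) = \sum_(0 <= i < m) e (u i) * b i y.
Proof.
move=> Ee; rewrite (linear_on_sum [set: X] e _ _ _ setT_subspace (E_linear e Ee) (fun=> I)).
apply: eq_bigr => i _.
by rewrite (linear_onZ [set: X] e (b i y) (u i) setT_subspace (E_linear e Ee) I) mulrC.
Qed.

Let d_gt0 m : 0 < d m. Proof. by rewrite exprn_gt0// invr_gt0. Qed.

Let w_gt1 m : 1 < w m. Proof. by rewrite ltrDl invr_gt0. Qed.

Let w_le2 m : w m <= 2.
Proof. by rewrite /w -[leRHS]/(1 + 1) lerD2l invf_le1// ler1n. Qed.

(** The grid approximates the vectors [(e (u 0), ..., e (u (m-1)), s)] with [s] a sign; the free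
    last entry is what produces the extra summand [|r m|]. *)
Lemma grid_functionals m : exists G : set (nat -> R), [/\ finite_set G,
    forall g, G g -> exists e, exists s, [/\ E e, `|s| = 1,
      forall i, (i < m)%N -> `|g i - e (u i)| <= d m & `|g m - s| <= d m] &
    forall e (r : nat -> R), E e -> exists2 g, G g &
      `|\sum_(0 <= i < m) e (u i) * r i| + `|r m| <=
      `|\sum_(0 <= i < m.+1) g i * r i| ].
Proof.
pose ext e (s : R) i := if (i < m)%N then e (u i) else s.
pose K := [set c | exists e, exists s, [/\ E e, `|s| = 1 & c = ext e s]].
have [|c i [e [s [Ee s1 ->]]] _|G [Gfin GK KG]] :=
    finite_grid m.+1 K (C * (\sum_(0 <= i < m) `|u i|) + 1) (d m).
- exact: d_gt0.
- have S0 : 0 <= C * \sum_(0 <= i < m) `|u i|.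
    by rewrite mulr_ge0 ?(ltW C0)// sumr_ge0.
  rewrite /ext; case: ifPn => im; last by rewrite s1 lerDr.
  apply: (le_trans (EC _ Ee _)); apply: (@le_trans _ _ (C * \sum_(0 <= i < m) `|u i|)).
    rewrite ler_wpM2l ?(ltW C0)// big_mkord (bigD1 (Ordinal im))//= lerDl.
    exact: sumr_ge0.
  by rewrite lerDl.
exists G; split=> // [g /GK[c [e [s [Ee s1 ->]]] gc]|e r Ee].
  exists e, s; split=> // [i im|].
    by have := gc i (ltnW im); rewrite /ext im.
  by have := gc m (ltnSn m); rewrite /ext ltnn.
pose S := \sum_(0 <= i < m) e (u i) * r i.
pose sg (x : R) : R := if 0 <= x then 1 else -1.
have sg1 x : `|sg x| = 1 by rewrite /sg; case: ifP; rewrite ?normrN normr1.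
have sgM x : sg x * x = `|x|.
  rewrite /sg; case: ifPn => [x0|]; first by rewrite mul1r ger0_norm.
  by rewrite -ltNge => x0; rewrite mulN1r ltr0_norm.
(* With this sign the last term agrees in sign with [S], so the absolute values add up. *)
have Kc : K (ext e (sg S * sg (r m))).
  by exists e, (sg S * sg (r m)); split=> //; rewrite normrM !sg1 mulr1.
have [g Gg h] := KG _ (fun i => sg S * r i) Kc.
exists g => //.
apply: (@le_trans _ _ (sg S * \sum_(0 <= i < m.+1) g i * r i)); last first.
  by apply: le_trans (ler_norm _) _; rewrite normrM sg1 mul1r.
have -> : sg S * (\sum_(0 <= i < m.+1) g i * r i) =
    \sum_(0 <= i < m.+1) g i * (sg S * r i).
  by rewrite mulr_sumr; apply: eq_bigr => i _; rewrite mulrCA.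
apply: le_trans h; rewrite big_nat_recr//= /ext ltnn -/(ext _ _).
have -> : \sum_(0 <= i < m) (if (i < m)%N then e (u i) else sg S * sg (r m)) *
    (sg S * r i) = sg S * S.
  rewrite mulr_sumr; apply: eq_big_nat => i /andP[_ ->]; ring.
rewrite sgM lerD2l mulrACA -expr2 -real_normK ?num_real// sg1 expr1n mul1r.
by rewrite mulrC -sgM mulrC.
Qed.

(** The terms from [m] on contribute at most [|b m y|] times the tail sum of [|e (u i)|]; passing
    from finite sums to [y] costs an arbitrarily small [eps], since [e] is bounded. *)
Let e_tail e y m : E e -> Y y ->
  (forall n, (m <= n)%N -> \sum_(m <= i < n) `|e (u i)| <= 1) ->
  (forall j, (m <= j)%N -> `|b j y| <= `|b m y|) ->
  `|e y| <= `|e (Q y m)| + `|b m y|.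
Proof.
move=> Ee Yy em bm; apply/ler_addgt0Pr => eps eps0.
have /cvgn_distP/(_ (eps / C)) [|N hN] := Qcvg y Yy; first exact: divr_gt0.
pose n := maxn m N; have mn : (m <= n)%N by exact: leq_maxl.
have : `|e (Q y n - y)| < eps.
  apply: (le_lt_trans (EC e Ee _)); rewrite mulrC -ltr_pdivlMr//.
  by apply: hN; exact: leq_maxr.
rewrite (linear_onB [set: X] e _ _ (E_linear e Ee) I I).
have -> : e (Q y n) = e (Q y m) + \sum_(m <= i < n) e (u i) * b i y.
  by rewrite !E_Q// -big_cat_nat.
have : `|\sum_(m <= i < n) e (u i) * b i y| <= `|b m y|.
  apply: le_trans (ler_norm_sum _ _ _) _.
  apply: (@le_trans _ _ (\sum_(m <= i < n) `|e (u i)| * `|b m y|)).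
    rewrite !big_nat; apply: ler_sum => i /andP[mi _].
    by rewrite normrM ler_wpM2l// bm.
  by rewrite -mulr_suml ler_piMl// em.
set S := \sum_(_ <= _ < _) _ => hS h.
have : `|e y| <= `|e (Q y m) + S| + eps.
  rewrite -[e y](subrK (e (Q y m) + S)) addrC; apply: le_trans (ler_normD _ _) _.
  by rewrite lerD2l distrC ltW.
by move=> /le_trans; apply; rewrite lerD2r; apply: le_trans (ler_normD _ _) _; rewrite lerD2l.
Qed.

Theorem iso_polyhedral_of_expansion : iso_polyhedral Y.
Proof.
have [G GP] := choice grid_functionals.
pose phi m (g : nat -> R) y := w m * \sum_(0 <= i < m.+1) g i * b i y.
pose B := \bigcup_m (phi m @` G m).
have w0 m : 0 < w m by exact: lt_trans ltr01 (w_gt1 m).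
have q0 y : y != 0 -> 0 < q y.
  by move=> y0; apply: lt_le_trans (Elow y); rewrite divr_gt0// normr_gt0.
have BL f : B f -> linear_on Y f.
  move=> [m _ [g _ <-]] a x y Yx Yy; rewrite /phi.
  have := linear_on_lincomb Y _ (index_iota 0 m.+1) b g bL a x y Yx Yy.
  by move=> /= ->; ring.
(* Replace the grid point by the vector of some [e] that it approximates; the rounding errors form
   the last summand. *)
have phi_le m g y : G m g -> Y y -> exists2 e, E e &
    `|phi m g y| <= w m * (`|e (Q y m)| + `|b m y| + m.+1%:R^-1 * (M * `|y|)).
  move=> Gg Yy; have [_ /(_ g Gg)[e [s [Ee s1 ge gs]]] _] := GP m.
  exists e => //; rewrite normrM gtr0_norm// ler_wpM2l ?(ltW (w0 m))//.
  rewrite big_nat_recr//=.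
  have -> : \sum_(0 <= i < m) g i * b i y + g m * b m y =
      e (Q y m) + s * b m y +
      (\sum_(0 <= i < m) (g i - e (u i)) * b i y + (g m - s) * b m y).
    under [X in _ + (X + _)]eq_bigr => i _ do rewrite mulrBl.
    by rewrite sumrB E_Q//; ring.
  apply: le_trans (ler_normD _ _) _; apply: lerD.
    by apply: le_trans (ler_normD _ _) _; rewrite lerD2l normrM s1 mul1r.
  have my0 : 0 <= M * `|y| by rewrite mulr_ge0// ltW.
  apply: le_trans (ler_normD _ _) _.
  apply: (@le_trans _ _ (\sum_(0 <= i < m) d m * (M * `|y|) + d m * (M * `|y|))).
    apply: lerD; last by rewrite normrM ler_pM// bM.
    apply: le_trans (ler_norm_sum _ _ _) _; rewrite !big_nat; apply: ler_sum.
    by move=> i /andP[_ im]; rewrite normrM ler_pM// ?bM// ge.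
  rewrite sumr_const_nat subn0 -mulrSr /d le_eqVlt; apply/orP; left; apply/eqP.
  by rewrite -[LHS]mulr_natl expr2 -!mulrA mulVKf// pnatr_eq0.
pose M' := 2 * (C * M + M + M).
have M'0 : 0 < M' by rewrite mulr_gt0// !addr_gt0// mulr_gt0.
have BM f y : B f -> Y y -> `|f y| <= M' * `|y|.
  move=> [m _ [g Gg <-]] Yy; have [e Ee h] := phi_le m g y Gg Yy.
  apply: (le_trans h); rewrite /M' -mulrA; apply: ler_pM => //.
  - by rewrite ltW.
  - by rewrite !addr_ge0// mulr_ge0 ?invr_ge0// mulr_ge0// ltW.
  rewrite !mulrDl; apply: lerD; first apply: lerD.
  - apply: (le_trans (EC e Ee _)); rewrite -mulrA ler_wpM2l ?(ltW C0)//.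
    exact: QM.
  - exact: bM.
  - by rewrite ler_piMl ?invf_le1 ?ler1n// mulr_ge0// ltW.
have phi_ge y : Y y -> exists m g, G m g /\ w m * q y <= `|phi m g y|.
  move=> Yy; have [e Ee eq_y] := Eatt y.
  (* Two partial sums within [1/2] of the limit differ by at most 1, as [e_tail] requires. *)
  have [l /cvgn_distP/(_ 2^-1)[|N hN]] := (cvg_ex _).1 (Eu e Ee).
    by rewrite invr_gt0.
  have [p Np pmax] := exists_tail_max (fun j => `|b j y|) N
    (fun=> normr_ge0 _) (cvgn_norm0 _ (bcvg0 y Yy)).
  have [_ _ /(_ e (fun i => b i y) Ee)[g Gg h]] := GP p.
  exists p, g; split=> //; rewrite normrM gtr0_norm// ler_wpM2l ?(ltW (w0 p))//.
  rewrite {1}/q -eq_y; apply: le_trans h; rewrite -E_Q//; apply: e_tail => // n pn.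
  have := hN n (leq_trans Np pn); have := hN p Np.
  rewrite !ltr_norml => /andP[h1 h2] /andP[h3 h4].
  have := sub_series_geq (fun n => `|e (u n)|) pn => <-; lra.
have B0 : B !=set0.
  by have [m [g [Gg _]]] := phi_ge 0 (proj1 YS); exists (phi m g), m => //; exists g.
have Bphi m g : G m g -> B (phi m g) by move=> Gg; exists m => //; exists g.
have NB f y : B f -> Y y -> `|f y| <= family_norm B y.
  exact: (family_norm_ge Y B M').
have qN y : Y y -> y != 0 -> q y < family_norm B y.
  move=> Yy y0; have [m [g [Gg h]]] := phi_ge y Yy.
  apply: lt_le_trans (NB _ y (Bphi m g Gg) Yy); apply: lt_le_trans h.
  by rewrite ltr_pMl// q0.
have kN y : Y y -> C^-1 * `|y| <= family_norm B y.
  move=> Yy; rewrite mulrC; have [->|y0] := eqVneq y 0.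
    by rewrite normr0 mul0r (family_norm_ge0 Y B M')//; exact: (proj1 YS).
  by apply: le_trans (Elow y) _; exact: ltW (qN y Yy y0).
have gap y : Y y -> y != 0 -> exists (rho : R) (J : set (X -> R)),
    [/\ rho < family_norm B y, finite_set J &
        forall f, B f -> ~ J f -> `|f y| <= rho].
  move=> Yy y0; have qNy := qN y Yy y0.
  (* This bounds all functionals of level [m] at [y] and tends to [q y], strictly below the norm.
     Hence finitely many levels form [J], and [rho] is the midpoint. *)
  pose r m := w m * (q y + C * `|Q y m - y| + `|b m y| + m.+1%:R^-1 * (M * `|y|)).
  have rq : r @ \oo --> (1 + 0) * (q y + C * 0 + 0 + 0 * (M * `|y|)).
    have h0 : (fun m => m.+1%:R^-1 : R) @ \oo --> (0 : R) by exact: cvg_harmonic.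
    apply: cvgM; first by apply: cvgD => //; exact: cvg_cst.
    apply: cvgD; last by apply: cvgM => //; exact: cvg_cst.
    apply: cvgD; last exact: cvgn_norm0 _ (bcvg0 y Yy).
    apply: cvgD; first exact: cvg_cst.
    apply: cvgM; first exact: cvg_cst.
    apply: cvgn_norm0; apply/cvgn_distP => eps eps0.
    have /cvgn_distP/(_ eps eps0)[N hN] := Qcvg y Yy.
    by exists N => n /hN; rewrite subr0.
  move: rq; rewrite addr0 mul1r mulr0 mul0r !addr0 => /cvgn_distP.
  move=> /(_ ((family_norm B y - q y) / 2))[|N hN].
    by rewrite divr_gt0// subr_gt0.
  exists ((family_norm B y + q y) / 2), (\bigcup_(m < N) (phi m @` G m)); split.
  - lra.
  - by apply: bigcup_finite => // m _; apply: finite_image; have [] := GP m.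
  move=> _ [m _ [g Gg <-]] Jphi.
  have Nm : (N <= m)%N.
    by rewrite leqNgt; apply/negP => mN; apply: Jphi; exists m => //; exists g.
  have [e Ee h] := phi_le m g y Gg Yy.
  have : `|phi m g y| <= r m.
    apply: (le_trans h); rewrite ler_wpM2l ?(ltW (w0 m))// !lerD2r.
    have -> : e (Q y m) = e y + e (Q y m - y).
      by rewrite (linear_onB [set: X] e _ _ (E_linear e Ee) I I); ring.
    apply: le_trans (ler_normD _ _) _.
    by apply: lerD; [exact: q_ge|exact: EC].
  have := hN m Nm; rewrite ltr_norml => /andP[_]; lra.
exists (family_norm B); split.
  apply: (family_norm_equiv Y B M' YS B0 BL M'0 BM C^-1) => //.
  by rewrite invr_gt0.
apply: (polyhedral_family_norm Y B M' YS B0 BL M'0 BM C^-1) => //.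
by rewrite invr_gt0.
Qed.

End Expansion.

(** * The basis constant *)

Lemma cauchy_cvgn {R : realType} {V : completeNormedModType R} (v : nat -> V) :
  (forall eps : R, 0 < eps ->
    exists N, forall m, (N <= m)%N -> `|v m - v N| < eps) ->
  exists l : V, v @ \oo --> l.
Proof.
move=> vC; suff vc : cvgn v by exists (limn v).
apply: cauchy_cvg; apply: cauchy_exP => eps eps0.
have [N hN] := vC eps eps0; exists (v N); exists N => // m /= /hN.
by rewrite -ball_normE/= distrC.
Qed.

Lemma lim_dist_le {R : realType} {V : normedModType R} (v : nat -> V) l y N
    (r : R) :
  v @ \oo --> (l : V) -> (forall m, (N <= m)%N -> `|v m - y| <= r) -> `|l - y| <= r.
Proof.
move=> /cvgn_distP vl vr; apply/ler_addgt0Pr => eps /vl[N' hN'].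
have := vr (maxn N N') (leq_maxl _ _); have := hN' (maxn N N') (leq_maxr _ _).
rewrite distrC; have := ler_distD (v (maxn N N')) l y; lra.
Qed.

Lemma exists_half_expr_lt {R : realType} (c eps : R) : 0 <= c -> 0 < eps ->
  exists n, c * 2^-1 ^+ n < eps.
Proof.
move=> c0 eps0; have /cvgn_distP/(_ (eps / (c + 1))) : (fun n => 2^-1 ^+ n : R) @ \oo --> (0 : R).
  by apply: cvg_expr; rewrite ger0_norm ?invr_ge0// invf_lt1 ?ltr1n.
have c1 : 0 < c + 1 by rewrite ltr_wpDl.
case=> [|N /(_ N (leqnn N))]; first exact: divr_gt0.
rewrite subr0 ger0_norm ?exprn_ge0 ?invr_ge0// ltr_pdivlMr// => h; exists N.
have : 0 <= 2^-1 ^+ N :> R by rewrite exprn_ge0 ?invr_ge0.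
by move: h; rewrite mulrDr mulr1 mulrC; lra.
Qed.

(** Otherwise one builds nested balls with centres in [Y], the one chosen at stage [k] avoiding
    [F k]; the limit of the centres lies in [Y] but in no [F k]. The [F k] are not assumed closed,
    so the conclusion is density in a relative ball. *)
Lemma baire_cover {R : realType} {X : completeNormedModType R} (Y : set X)
    (F : nat -> set X) :
  closed Y -> Y !=set0 -> Y `<=` \bigcup_k F k ->
  exists k y (r : R), [/\ Y y, 0 < r & forall z, Y z -> `|z - y| < r ->
    forall eps : R, 0 < eps -> exists2 f, F k f & `|f - z| < eps].
Proof.
move=> Ycl [y0 Yy0] YF; apply: contrapT => none.
pose good k (p p' : X * R) := Y p.1 -> 0 < p.2 ->
  [/\ Y p'.1, 0 < p'.2, `|p'.1 - p.1| + p'.2 <= p.2, p'.2 <= p.2 / 2 &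
      forall f, F k f -> p'.2 < `|f - p'.1|].
have step (kp : nat * (X * R)) : exists p', good kp.1 kp.2 p'.
  case: kp => k [y r] /=; have [[Yy r0]|h] := pselect (Y y /\ 0 < r); last first.
    by exists (y, r) => /= Yy r0; exfalso; exact: h.
  have [z [Yz zy [eps eps0 Feps]]] : exists z, [/\ Y z, `|z - y| < r &
      exists2 eps : R, 0 < eps & forall f, F k f -> eps <= `|f - z|].
    apply: contrapT => h; apply: none; exists k, y, r; split=> // z Yz zy eps eps0.
    apply: contrapT => hf; apply: h; exists z; split=> //; exists eps => // f Ff.
    by rewrite leNgt; apply/negP => fz; apply: hf; exists f.
  (* The first bound keeps the new ball away from [F k], the second keeps it inside the old one;
     halving makes the first strict. *)
  exists (z, Num.min eps (r - `|z - y|) / 2) => _ _ /=.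
  have m0 : 0 < Num.min eps (r - `|z - y|) by rewrite lt_min eps0 subr_gt0.
  have m1 : Num.min eps (r - `|z - y|) <= eps by rewrite ge_min lexx.
  have m2 : Num.min eps (r - `|z - y|) <= r - `|z - y| by rewrite ge_min lexx orbT.
  split=> //; first by rewrite divr_gt0.
  - lra.
  - by have := normr_ge0 (z - y); lra.
  - by move=> f /Feps; lra.
have [next nextP] := choice step.
pose p := fix p n := if n is m.+1 then next (m, p m) else (y0, 1).
have pP n : Y (p n).1 /\ 0 < (p n).2.
  by elim: n => [|n [IH1 IH2]]//=; have [] := nextP (n, p n) IH1 IH2.
have pS n := nextP (n, p n) (pP n).1 (pP n).2.
have pdist n m : (n <= m)%N -> `|(p m).1 - (p n).1| + (p m).2 <= (p n).2.
  move=> /subnK <-; elim: (m - n)%N => [|i IH]; first by rewrite add0n subrr normr0 add0r.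
  have [_ _ h _ _] := pS (i + n)%N; rewrite addSn.
  have := ler_distD (p (i + n)%N).1 (p (i + n).+1).1 (p n).1.
  by move: h IH => /=; lra.
have pexp n : (p n).2 <= 1 * 2^-1 ^+ n.
  elim: n => [|n IH]; first by rewrite expr0 mulr1.
  by have [_ _ _ h _] := pS n; rewrite exprS; move: h => /=; lra.
have [l pl] : exists l : X, (fun n => (p n).1) @ \oo --> l.
  apply: cauchy_cvgn => eps eps0.
  have [N hN] := exists_half_expr_lt 1 eps ler01 eps0; exists N => m Nm.
  by have := pdist N m Nm; have := pexp N; have := (pP m).2; lra.
have lp n : `|l - (p n).1| <= (p n).2.
  apply: (lim_dist_le _ _ _ n _ pl) => m nm.
  by have := pdist n m nm; have := (pP m).2; lra.
have Yl : Y l.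
  by apply: (closed_cvg Y Ycl _ _ pl); apply: nearW => n; exact: (pP n).1.
have [k _ Fl] := YF l Yl; have [_ _ _ _ /(_ l Fl)] := pS k.
by have /= := lp k.+1; move=> /le_lt_trans h /h; rewrite ltxx.
Qed.

Section ClosedSpan.
Context {R : realType} {X : normedModType R}.
Implicit Type S : set X.

Lemma closed_spanP S y : closed_span S y <->
  forall eps : R, 0 < eps -> exists2 z, lin_span S z & `|z - y| < eps.
Proof.
split=> [cy eps eps0|h].
  have [z [Sz yz]] := cy _ (nbhsx_ballx y eps eps0).
  by exists z => //; move: yz; rewrite -ball_normE/= distrC.
move=> U /nbhs_ballP[eps /= eps0 yU]; have [z Sz zy] := h eps eps0.
by exists z; split=> //; apply: yU; rewrite -ball_normE/= distrC.
Qed.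

Lemma sub_closed_span S : S `<=` closed_span S.
Proof. by move=> y Sy; apply/subset_closure/sub_lin_span. Qed.

Lemma linear_subspace_closed_span S : linear_subspace (closed_span S).
Proof.
have spanS := linear_subspace_lin_span S.
split; first by apply: subset_closure; exact: (proj1 spanS).
move=> a u v /closed_spanP Su /closed_spanP Sv; apply/closed_spanP => eps eps0.
have a1 : 0 < `|a| + 1 by rewrite ltr_wpDl.
have [|u' Su' uu'] := Su (eps / 2 / (`|a| + 1)).
  by rewrite !divr_gt0.
have [|v' Sv' vv'] := Sv (eps / 2); first by rewrite divr_gt0.
exists (a *: u' + v'); first exact: (proj2 spanS).
rewrite opprD addrACA -scalerBr; apply: (le_lt_trans (ler_normD _ _)).
rewrite normrZ; move: uu'; rewrite ltr_pdivlMr// => uu'.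
by have := normr_ge0 (u' - u); move: uu' vv'; rewrite mulrDr mulr1 mulrC; lra.
Qed.

End ClosedSpan.

(** * Coordinates and partial sums of a basic sequence *)

Section BasicSequence.
Context {R : realType} {X : completeNormedModType R} (x : nat -> X).
Context (x_basic : basic_seq x) (theta : R) (theta0 : 0 < theta).
Context (x_ge : forall n, theta <= `|x n|).

Let Y := closed_span (range x).
Let YS : linear_subspace Y. Proof. exact: linear_subspace_closed_span. Qed.

Definition partial_sum (c : nat -> R) (n : nat) : X := \sum_(0 <= i < n) c i *: x i.

Lemma partial_sumD a c c' n :
  partial_sum (fun i => a * c i + c' i) n = a *: partial_sum c n + partial_sum c' n.
Proof.
rewrite /partial_sum scaler_sumr -big_split/=; apply: eq_bigr => i _.
by rewrite scalerDl scalerA.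
Qed.

Lemma exists_coordinates : exists a : X -> nat -> R,
  (forall y, Y y -> partial_sum (a y) @ \oo --> y) /\
  (forall y c, Y y -> partial_sum c @ \oo --> y -> c = a y).
Proof.
have ex y : exists c : nat -> R, Y y -> partial_sum c @ \oo --> y /\
    forall c', partial_sum c' @ \oo --> y -> c' = c.
  have [Yy|nY] := pselect (Y y); last by exists (fun=> 0).
  by have [c [cy cuniq]] := x_basic y Yy; exists c => _; split=> // c' /cuniq.
have [a aP] := choice ex; exists a; split=> [y /aP[]//|y c /aP[_]]; exact.
Qed.

Context (a : X -> nat -> R).
Context (a_cvg : forall y, Y y -> partial_sum (a y) @ \oo --> y).
Context (a_uniq : forall y c, Y y -> partial_sum c @ \oo --> y -> c = a y).

Lemma coordinate_linear i : linear_on Y (a ^~ i).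
Proof.
move=> t u v Yu Yv.
rewrite -(a_uniq (t *: u + v) (fun i => t * a u i + a v i))//.
  by have [_] := YS; exact.
rewrite (_ : partial_sum _ = fun n => t *: partial_sum (a u) n + partial_sum (a v) n).
  by apply: cvgD; [apply: cvgZl_tmp; exact: a_cvg|exact: a_cvg].
by apply/funext => n; exact: partial_sumD.
Qed.

Lemma coordinate_basis k i : a (x k) i = (i == k)%:R.
Proof.
rewrite -(a_uniq (x k) (fun i => (i == k)%:R))//.
  by apply: sub_closed_span; exists k.
apply/cvgn_distP => eps eps0; exists k.+1 => n kn.
rewrite /partial_sum big_mkord (bigD1 (Ordinal kn))//= eqxx scale1r big1 ?addr0 ?subrr ?normr0//.
by move=> j; rewrite -val_eqE/= => /negPf ->; rewrite scale0r.
Qed.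

Let psum_linear n : forall t u v, Y u -> Y v ->
  partial_sum (a (t *: u + v)) n = t *: partial_sum (a u) n + partial_sum (a v) n.
Proof.
move=> t u v Yu Yv; rewrite -partial_sumD; apply: eq_bigr => i _.
by rewrite coordinate_linear.
Qed.

Let psumB n u v : Y u -> Y v ->
  partial_sum (a (u - v)) n = partial_sum (a u) n - partial_sum (a v) n.
Proof. by move=> Yu Yv; rewrite addrC -scaleN1r psum_linear// scaleN1r addrC. Qed.

Let psum0 n : partial_sum (a 0) n = 0.
Proof. by rewrite -(subrr (0 : X)) psumB ?subrr//; exact: (proj1 YS). Qed.

Let psumZ n t u : Y u -> partial_sum (a (t *: u)) n = t *: partial_sum (a u) n.
Proof.
by move=> Yu; rewrite -[t *: u]addr0 psum_linear// ?psum0 ?addr0//; exact: (proj1 YS).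
Qed.

(* Baire makes the set of vectors with bounded partial sums dense in a ball of
   the span; homogeneity then turns this into approximation with a uniform
   constant at every scale. *)
Lemma dense_bounded_partial_sums : exists2 L : R, 0 <= L &
  forall y (eps : R), Y y -> 0 < eps -> exists f, [/\ Y f, `|f - y| < eps &
    forall n, `|partial_sum (a f) n| <= L * `|y|].
Proof.
pose F (k : nat) := [set y | Y y /\ forall n, `|partial_sum (a y) n| <= k%:R].
have Ycl : closed Y by exact: closed_closure.
have [||k [y0 [r [Yy0 r0 yr]]]] := baire_cover Y F Ycl.
- by exists 0; exact: (proj1 YS).
- move=> y Yy; have [A [_ hA]] := cvg_seq_bounded (cvgP y (a_cvg y Yy)).
  have /hA bA : A < `|A| + 1 by rewrite ltr_pwDr// ler_norm.
  exists (Num.trunc (`|A| + 1)).+1 => //; split=> // n.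
  apply: (le_trans (bA n I)); apply: ltW.
  by have /andP[] := truncn_itv (addr_ge0 (normr_ge0 A) ler01).
(* Subtracting approximants of [y0 + y] and of [y0] recentres the ball at 0 and doubles the
   bound. *)
have near0 y (eps : R) : Y y -> `|y| < r -> 0 < eps -> exists f,
    [/\ Y f, `|f - y| < eps & forall n, `|partial_sum (a f) n| <= 2 * k%:R].
  move=> Yy yr0 eps0; have e2 : 0 < eps / 2 by rewrite divr_gt0.
  have Yy0y : Y (y0 + y) by exact: (linear_subspaceD Y _ _ YS).
  have y0yr : `|y0 + y - y0| < r by rewrite addrAC subrr add0r.
  have y0r : `|y0 - y0| < r by rewrite subrr normr0.
  have [f1 [Yf1 Ff1] f1y] := yr (y0 + y) Yy0y y0yr (eps / 2) e2.
  have [f0 [Yf0 Ff0] f0y] := yr y0 Yy0 y0r (eps / 2) e2.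
  exists (f1 - f0); split; first exact: (linear_subspaceB Y _ _ YS).
    rewrite (_ : f1 - f0 - y = (f1 - (y0 + y)) - (f0 - y0)).
      by apply: (le_lt_trans (ler_normB _ _)); lra.
    rewrite opprB opprD -[LHS]addrA -[RHS]addrA; congr (_ + _).
    by rewrite addrACA addNr add0r addrC.
  move=> n; rewrite psumB//; apply: (le_trans (ler_normB _ _)).
  by have := Ff1 n; have := Ff0 n; lra.
(* Rescaling [y] to norm [r / 2] gives the bound [2 * k%:R]; scaling back divides by [r / 2] and
   multiplies by [|y|]. *)
exists (4 * k%:R / r) => [|y eps Yy eps0].
  by rewrite divr_ge0 ?mulr_ge0// ltW.
have [->|y0'] := eqVneq y 0.
  exists 0; split; [exact: (proj1 YS)|by rewrite subrr normr0|].
  by move=> n; rewrite psum0 !normr0 mulr0.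
have ny : 0 < `|y| by rewrite normr_gt0.
pose t := r / 2 / `|y|; have t0 : 0 < t by rewrite !divr_gt0.
have [|||f [Yf fy fn]] := near0 (t *: y) (eps * t).
- exact: (linear_subspaceZ Y _ _ YS).
- by rewrite normrZ gtr0_norm// /t mulfVK ?gt_eqF//; lra.
- exact: mulr_gt0.
exists (t^-1 *: f); split; first exact: (linear_subspaceZ Y _ _ YS).
  rewrite -[y](scalerK (lt0r_neq0 t0)) -scalerBr normrZ gtr0_norm ?invr_gt0//.
  by rewrite mulrC ltr_pdivrMr.
move=> n; rewrite psumZ// normrZ gtr0_norm ?invr_gt0// mulrC ler_pdivrMr//.
apply: (le_trans (fn n)); rewrite /t le_eqVlt; apply/orP; left; apply/eqP.
by field; rewrite !gt_eqF.
Qed.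

(** Successive approximation: subtracting approximants with controlled partial sums leaves
    remainders of norm at most [2^-i |y|]. Their partial sums converge uniformly in the length, and
    the limits are the partial sums of a series with sum 0. Uniqueness makes that series zero, so
    the partial sums of [y] are bounded by those of the approximants. *)
Lemma basis_constant : exists2 K : R, 0 < K &
  forall y n, Y y -> `|partial_sum (a y) n| <= K * `|y|.
Proof.
have [L L0 hL] := dense_bounded_partial_sums.
exists (2 * L + 1) => [|y n Yy]; first by rewrite ltr_wpDl// mulr_ge0.
have [->|y0] := eqVneq y 0; first by rewrite psum0 !normr0 mulr0.
have ny : 0 < `|y| by rewrite normr_gt0.
have half_gt0 i : 0 < 2^-1 ^+ i :> R by rewrite exprn_gt0// invr_gt0.
have ex (p : X * R) : exists f, Y p.1 -> 0 < p.2 -> [/\ Y f, `|f - p.1| < p.2 &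
    forall n, `|partial_sum (a f) n| <= L * `|p.1|].
  have [[Yp p0]|h] := pselect (Y p.1 /\ 0 < p.2); last first.
    by exists 0 => Yp p0; exfalso; apply: h.
  by have [f fP] := hL p.1 p.2 Yp p0; exists f.
have [h hP] := choice ex.
pose rem := fix rem i :=
  if i is j.+1 then rem j - h (rem j, `|y| * 2^-1 ^+ j.+1) else y.
have hrem i : Y (rem i) -> [/\ Y (h (rem i, `|y| * 2^-1 ^+ i.+1)),
    `|rem i.+1| < `|y| * 2^-1 ^+ i.+1 &
    forall n, `|partial_sum (a (h (rem i, `|y| * 2^-1 ^+ i.+1))) n| <= L * `|rem i|].
  move=> Yr; have [|Yh hr hn] := hP (rem i, `|y| * 2^-1 ^+ i.+1) Yr.
    by rewrite /= mulr_gt0.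
  by split=> //; rewrite /= distrC.
have Yrem i : Y (rem i).
  elim: i => [//|i IH]; have [Yh _ _] := hrem i IH.
  exact: (linear_subspaceB Y _ _ YS).
have rem_le i : `|rem i| <= `|y| * 2^-1 ^+ i.
  by case: i => [|i]; [rewrite expr0 mulr1|have [_ /ltW] := hrem i (Yrem i)].
pose D k n := partial_sum (a (rem k)) n.
have DB k l m : (k <= l)%N ->
    `|D l m - D k m| <= 2 * L * `|y| * (2^-1 ^+ k - 2^-1 ^+ l).
  move=> /subnK <-; elim: (l - k)%N => [|i IH].
    by rewrite add0n !subrr normr0 mulr0.
  have [Yh _ /(_ m) hn] := hrem (i + k)%N (Yrem _).
  have -> : D (i.+1 + k)%N m - D k m = (D (i + k)%N m - D k m) -
      partial_sum (a (h (rem (i + k)%N, `|y| * 2^-1 ^+ (i + k).+1))) m.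
    by rewrite /D addSn /= psumB// addrAC.
  apply: (le_trans (ler_normB _ _)).
  have : L * `|rem (i + k)%N| <= L * (`|y| * 2^-1 ^+ (i + k)).
    by rewrite ler_wpM2l.
  move=> /(le_trans hn)/(lerD IH)/le_trans; apply; rewrite addSn exprS.
  by lra.
have DB' k l m : (k <= l)%N -> `|D l m - D k m| <= 2 * L * `|y| * 2^-1 ^+ k.
  move=> kl; apply: (le_trans (DB k l m kl)).
  by rewrite ler_wpM2l ?mulr_ge0// gerBl ltW.
(* Each coordinate of the remainders is Cauchy: its term is a difference of two partial sums, and
   [|x i|] is at least [theta]. *)
have /choice[tau tauP] : forall i, exists t : R,
    (fun l => a (rem l) i) @ \oo --> t.
  move=> i; apply: cauchy_cvgn => eps eps0.
  have [||k hk] := exists_half_expr_lt (4 * L * `|y|) (eps * theta).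
  - by rewrite !mulr_ge0.
  - exact: mulr_gt0.
  exists k => l kl; rewrite -(ltr_pM2r theta0).
  apply: (@le_lt_trans _ _ (`|a (rem l) i - a (rem k) i| * `|x i|)).
    by rewrite ler_wpM2l.
  rewrite -normrZ scalerBl.
  have aE l' : a (rem l') i *: x i = D l' i.+1 - D l' i.
    by rewrite /D /partial_sum big_nat_recr//= [RHS]addrC addKr.
  rewrite !aE (_ : _ - _ = (D l i.+1 - D k i.+1) - (D l i - D k i)).
    apply: (le_lt_trans (ler_normB _ _)).
    by have := DB' k l i kl; have := DB' k l i.+1 kl; lra.
  by rewrite !opprD !opprK addrACA.
pose T m := partial_sum tau m.
have DT m : (fun l => D l m) @ \oo --> T m.
  apply: cvg_big => [|i _]; first exact: add_continuous.
  exact: (cvgZr_tmp (a := x i) (tauP i)).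
have TD k m : `|T m - D k m| <= 2 * L * `|y| * 2^-1 ^+ k.
  by apply: (lim_dist_le _ _ _ k _ (DT m)) => l kl; exact: DB'.
(* For large fixed [k], [T] is uniformly close to the partial sums of [rem k], which converge to the
   small vector [rem k]. *)
have T0 : T @ \oo --> (0 : X).
  apply/cvgn_distP => eps eps0.
  have [||k hk] := exists_half_expr_lt ((2 * L + 1) * `|y|) (eps / 2).
  - by rewrite mulr_ge0// addr_ge0// mulr_ge0.
  - by rewrite divr_gt0.
  have /cvgn_distP/(_ (eps / 2))[|N hN] := a_cvg (rem k) (Yrem k).
    by rewrite divr_gt0.
  exists N => m Nm; rewrite subr0.
  rewrite (_ : T m = (T m - D k m) + (D k m - rem k) + rem k); last first.
    by rewrite addrA subrK subrK.
  apply: (le_lt_trans (ler_normD _ _)).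
  have := ler_normD (T m - D k m) (D k m - rem k).
  have := hN m Nm; have := TD k m; have := rem_le k; rewrite -/(D k m); lra.
have Y0 : Y 0 by exact: (proj1 YS).
have tau0 : tau = a 0 by exact: a_uniq.
have := TD 0%N n; rewrite /T tau0 psum0 sub0r normrN expr0 mulr1.
by have := normr_ge0 y; lra.
Qed.

End BasicSequence.

(** * Subsequences *)

Lemma nonneg_series_cvgn {R : realType} (f : nat -> R) (A : R) :
  (forall n, 0 <= f n) -> (forall n, \sum_(0 <= i < n) f i <= A) ->
  cvgn [series f n]_n.
Proof.
move=> f0 fA; apply: nondecreasing_is_cvgn.
  by apply: (@nondecreasing_series _ f predT) => n _ _; exact: f0.
by exists A => _ [n _ <-]; exact: fA.
Qed.

Lemma nonneg_series_bounded {R : realType} (f : nat -> R) :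
  (forall n, 0 <= f n) -> cvgn [series f n]_n ->
  exists k : nat, forall n, \sum_(0 <= i < n) f i <= k%:R.
Proof.
move=> f0 fcvg; exists (Num.trunc `|limn [series f n]_n|).+1 => n.
have := nondecreasing_cvgn_le _ fcvg n.
move=> /(_ (@nondecreasing_series _ f predT _ _)) h.
apply: (@le_trans _ _ (limn [series f n]_n)).
  by apply: h => i _ _; exact: f0.
apply: (le_trans (ler_norm _)); apply: ltW.
by have /andP[] := truncn_itv (normr_ge0 (limn [series f n]_n)).
Qed.

Section Subsequence.
Context {R : realType} {X : completeNormedModType R} (x : nat -> X).
Context (theta : R) (theta0 : 0 < theta) (x_ge : forall n, theta <= `|x n|).
Let Y := closed_span (range x).
Context (a : X -> nat -> R) (K : R) (K0 : 0 < K).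
Context (a_cvg : forall y, Y y -> partial_sum x (a y) @ \oo --> y).
Context (a_uniq : forall y c, Y y -> partial_sum x c @ \oo --> y -> c = a y).
Context (aK : forall y n, Y y -> `|partial_sum x (a y) n| <= K * `|y|).

Let YS : linear_subspace Y. Proof. exact: linear_subspace_closed_span. Qed.

Let aL i : linear_on Y (a ^~ i).
Proof. exact: coordinate_linear a_cvg a_uniq i. Qed.

Let a0 i : a 0 i = 0. Proof. exact: (linear_on0 Y (a ^~ i) YS (aL i)). Qed.

Let aZ i t u : Y u -> a (t *: u) i = t * a u i.
Proof. exact: (linear_onZ Y (a ^~ i) t u YS (aL i)). Qed.

Let aB i u v : Y u -> Y v -> a (u - v) i = a u i - a v i.
Proof. exact: (linear_onB Y (a ^~ i) u v (aL i)). Qed.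

Let aE k i : a (x k) i = (i == k)%:R.
Proof. exact: coordinate_basis a_uniq k i. Qed.

Lemma coordinate_term_diff y i : a y i *: x i =
  partial_sum x (a y) i.+1 - partial_sum x (a y) i.
Proof. by rewrite /partial_sum big_nat_recr//= [RHS]addrC addKr. Qed.

Lemma coordinate_term_bound y i : Y y -> `|a y i| * `|x i| <= 2 * K * `|y|.
Proof.
move=> Yy; rewrite -normrZ coordinate_term_diff; apply: (le_trans (ler_normB _ _)).
by have := aK y i Yy; have := aK y i.+1 Yy; lra.
Qed.

Lemma coordinate_bound y i : Y y -> `|a y i| <= 2 * K / theta * `|y|.
Proof.
move=> Yy; rewrite mulrAC ler_pdivlMr//.
by apply: le_trans (coordinate_term_bound y i Yy); rewrite ler_wpM2l.
Qed.

Lemma coordinate_term_cvg0 y : Y y -> (fun i => a y i *: x i) @ \oo --> (0 : X).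
Proof.
move=> Yy; apply/cvgn_distP => eps eps0.
have /cvgn_distP/(_ (eps / 2))[|N hN] := a_cvg y Yy; first by rewrite divr_gt0.
exists N => n Nn; rewrite subr0 coordinate_term_diff.
have := hN n Nn; have := hN n.+1 (leqW Nn); rewrite distrC.
set S := partial_sum _ _; have := ler_distD y (S n.+1) (S n).
by rewrite (distrC y (S n)) (distrC y (S n.+1)); lra.
Qed.

Lemma infinite_dim_subsequence (phi : nat -> nat) : injective phi ->
  infinite_dim (closed_span (range (x \o phi))).
Proof.
move=> phiI n; exists (fun i : 'I_n => x (phi i)); split.
  by move=> i; apply: sub_closed_span; exists i.
move=> c c0 k; have Yx i : Y (x i) by apply: sub_closed_span; exists i.
have := linear_on_sum Y (a ^~ (phi k)) _ (index_enum 'I_n)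
  (fun i => c i *: x (phi i)) YS (aL _).
rewrite c0 a0 => h; rewrite h.
  rewrite (bigD1 k)//= aZ// aE eqxx mulr1.
  rewrite big1 ?addr0// => i ik; rewrite aZ// aE.
  by rewrite (inj_eq phiI) eq_sym val_eqE (negPf ik) mulr0.
by move=> i; exact: (linear_subspaceZ Y _ _ YS).
Qed.

Context (phi : nat -> nat) (phi_lt : forall n, (phi n < phi n.+1)%N).
Let Z := closed_span (range (x \o phi)).

Let phi_mono : {mono phi : n m / (n <= m)%N}.
Proof. exact: leq_mono (homo_ltn ltn_trans phi_lt). Qed.

Let ZY : Z `<=` Y.
Proof.
apply: closure_subset => y [n [c [v [vr ->]]]]; exists n, c, v; split=> // i.
by have [j _ <-] := vr i; exists (phi j).
Qed.

(** The coordinate vanishes on the linear span and is bounded, so it vanishes on the closure. *)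
Lemma coordinate_off_subsequence y i : Z y -> ~ range phi i -> a y i = 0.
Proof.
move=> Zy ni; apply/eqP; rewrite -normr_le0; apply/ler_addgt0Pr => eps eps0.
rewrite add0r; have t0 : 0 < 2 * K / theta by rewrite divr_gt0// mulr_gt0.
have /closed_spanP/(_ (eps / (2 * K / theta)))[|z Sz zy] := Zy.
  exact: divr_gt0.
pose W := [set y | Y y /\ a y i = 0].
have WS : linear_subspace W.
  split; first by split; [exact: (proj1 YS)|exact: a0].
  move=> t u v [Yu u0] [Yv v0]; split; first exact: (proj2 YS).
  by rewrite aL// u0 v0 mulr0 addr0.
have [|Yz az0] := lin_span_min (range (x \o phi)) W WS _ z Sz.
  move=> _ [j _ <-]; split; first by apply: sub_closed_span; exists (phi j).
  rewrite aE; case: eqP => // ij; by exfalso; apply: ni; exists j.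
have -> : a y i = a (y - z) i.
  by rewrite aB// ?az0 ?subr0//; exact: ZY.
apply: (le_trans (coordinate_bound _ i _)).
  by apply: (linear_subspaceB Y _ _ YS) => //; exact: ZY.
by rewrite distrC mulrC -ler_pdivlMr// ltW.
Qed.

Lemma partial_sum_subsequence y n : Z y ->
  partial_sum x (a y) (phi n) = \sum_(0 <= j < n) a y (phi j) *: x (phi j).
Proof.
move=> Zy; have off i : ~ range phi i -> a y i *: x i = 0.
  by move=> ni; rewrite coordinate_off_subsequence// scale0r.
elim: n => [|n IH].
  rewrite big_geq// /partial_sum big_nat big1// => i /andP[_ i0].
  by apply: off => -[j _ ji]; move: i0; rewrite -ji ltnNge phi_mono.
rewrite big_nat_recr//= -IH /partial_sum (big_cat_nat (n := phi n))//=; last first.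
  by rewrite ltnW.
congr (_ + _); rewrite big_ltn//= big_nat big1 ?addr0// => i /andP[ni iS].
apply: off => -[j _ ji]; move: ni iS; rewrite -ji !ltnNge !phi_mono.
by move=> nj jn; rewrite -ltnNge ltnS in jn; rewrite jn in nj.
Qed.

(** The rescaled vectors [c n *: x (phi n)] form an expansion system whose coordinates are those of
    [x] divided by [c n]; the lower bound [t] keeps these bounded and sends them to 0. The weights
    allow an unbounded sequence to be scaled down. *)
Theorem subsequence_iso_polyhedral (E : set (X -> R)) (c : nat -> R) (t : R) :
  (forall e, E e -> dual_elem e) -> iso_precisely_norming E ->
  (forall n, 0 < c n) -> 0 < t -> (forall n, t <= c n * `|x (phi n)|) ->
  (forall e, E e -> cvgn [series `|e (c n *: x (phi n))|]_n) ->
  iso_polyhedral Z.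
Proof.
move=> Ed [C [C1 [EC [Elow Eatt]]]] c0 t0 tc Ec.
have ZS : linear_subspace Z by exact: linear_subspace_closed_span.
pose b i y := (c i)^-1 * a y (phi i).
have b_le i y : Y y -> `|b i y| <= t^-1 * `|a y (phi i) *: x (phi i)|.
  move=> Yy; rewrite /b normrM gtr0_norm ?invr_gt0// normrZ.
  have ci : (c i)^-1 <= t^-1 * `|x (phi i)|.
    by rewrite -[leLHS]mul1r ler_pdivrMr// -mulrA ler_pdivlMl// mulr1 mulrC.
  by rewrite mulrCA mulrC ler_wpM2l.
have QE y m : Z y -> \sum_(0 <= i < m) b i y *: (c i *: x (phi i)) =
    partial_sum x (a y) (phi m).
  move=> Zy; rewrite partial_sum_subsequence//; apply: eq_bigr => i _.
  by rewrite scalerA /b mulrAC mulVf ?gt_eqF// mul1r.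
have phi_ge n : (n <= phi n)%N.
  by elim: n => // n IH; exact: leq_ltn_trans (phi_lt n).
pose M := K + t^-1 * (2 * K).
have M0 : 0 < M by rewrite addr_gt0// mulr_gt0 ?invr_gt0// mulr_gt0.
apply: (iso_polyhedral_of_expansion Z E b (fun n => c n *: x (phi n)) C M) => //.
- apply: infinite_dim_subsequence => n m /eqP; rewrite eqn_leq !phi_mono.
  by rewrite -eqn_leq => /eqP.
- move=> i s u v Zu Zv; rewrite /b (aL (phi i))//; [ring|exact: ZY|exact: ZY].
- move=> i y /ZY Yy; apply: (le_trans (b_le i y Yy)).
  apply: (@le_trans _ _ (t^-1 * (2 * K) * `|y|)).
    rewrite -mulrA ler_wpM2l ?invr_ge0 ?(ltW t0)// normrZ.
    exact: coordinate_term_bound.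
  by rewrite ler_wpM2r// lerDr ltW.
- move=> y /ZY Yy; apply/cvgn_distP => eps eps0.
  have /cvgn_distP/(_ (eps * t))[|N hN] := coordinate_term_cvg0 y Yy.
    exact: mulr_gt0.
  exists N => n Nn; rewrite subr0; apply: (le_lt_trans (b_le n y Yy)).
  rewrite mulrC ltr_pdivrMr//.
  by have := hN (phi n) (leq_trans Nn (phi_ge n)); rewrite subr0.
- move=> y m Zy; rewrite QE//; apply: (le_trans (aK _ _ (ZY _ Zy))).
  by rewrite ler_wpM2r// lerDl mulr_ge0 ?invr_ge0 ?(ltW t0)// mulr_ge0// ltW.
- move=> y Zy; apply/cvgn_distP => eps eps0.
  have /cvgn_distP/(_ eps eps0)[N hN] := a_cvg y (ZY _ Zy).
  exists N => n Nn; rewrite QE//; apply: hN; exact: leq_trans (phi_ge n).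
Qed.

End Subsequence.

(** * Bounded sums of coordinates *)

Section BoundedSums.
Context {R : realType} {X : completeNormedModType R} (x : nat -> X).
Let Y := closed_span (range x).
Context (a : X -> nat -> R) (K : R) (K0 : 0 < K).
Context (a_cvg : forall y, Y y -> partial_sum x (a y) @ \oo --> y).
Context (a_uniq : forall y c, Y y -> partial_sum x c @ \oo --> y -> c = a y).
Context (aK : forall y n, Y y -> `|partial_sum x (a y) n| <= K * `|y|).
Context (D : R) (D0 : 0 < D) (xD : forall n, `|x n| <= D).
Let s n y : R := \sum_(0 <= i < n) a y i.
Context (S : R) (S0 : 0 < S) (sS : forall n y, Y y -> `|s n y| <= S * `|y|).

Let YS : linear_subspace Y. Proof. exact: linear_subspace_closed_span. Qed.

Let aL i : linear_on Y (a ^~ i).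
Proof. exact: coordinate_linear a_cvg a_uniq i. Qed.

Let sL n : linear_on Y (s n).
Proof.
move=> t u v Yu Yv; rewrite /s mulr_sumr -big_split/=; apply: eq_bigr => i _.
exact: aL.
Qed.

Let Ypsum c n : Y (partial_sum x c n).
Proof.
apply: (linear_subspace_sum Y _ _ _ YS) => i; apply: (linear_subspaceZ Y _ _ YS).
by apply: sub_closed_span; exists i.
Qed.

Let a_psum y n i : a (partial_sum x (a y) n) i = if (i < n)%N then a y i else 0.
Proof.
rewrite -(a_uniq _ (fun i => if (i < n)%N then a y i else 0))//.
apply/cvgn_distP => eps eps0; exists n => m nm.
rewrite (_ : partial_sum x _ m = partial_sum x (a y) n) ?subrr ?normr0//.
rewrite /partial_sum (big_cat_nat (n := n))//= addrC big_nat big1 ?add0r.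
  by apply: eq_big_nat => i' /andP[_ ->].
by move=> i' /andP[ni' _]; rewrite ltnNge ni' scale0r.
Qed.

(** Subtracting the [m]-th partial sum from [y] erases exactly the first [m] coordinates, so the
    difference is [s n] of the remainder. *)
Let s_tail y m n : Y y -> (m <= n)%N ->
  `|s n y - s m y| <= S * `|partial_sum x (a y) m - y|.
Proof.
move=> Yy mn; have -> : s n y - s m y = s n (y - partial_sum x (a y) m).
  rewrite (linear_onB Y _ _ _ (sL n))//; congr (_ - _).
  rewrite /s [RHS](big_cat_nat (n := m))//=.
  rewrite [X in _ = _ + X]big_nat [X in _ = _ + X]big1 ?addr0.
    by apply: eq_big_nat => i /andP[_ im]; rewrite a_psum im.
  by move=> i /andP[mi _]; rewrite a_psum ltnNge mi.
by rewrite distrC; apply: sS; exact: (linear_subspaceB Y _ _ YS).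
Qed.

Let s_cvg y : Y y -> exists l : R, s ^~ y @ \oo --> l.
Proof.
move=> Yy; apply: cauchy_cvgn => eps eps0.
have /cvgn_distP/(_ (eps / S))[|N hN] := a_cvg y Yy; first exact: divr_gt0.
exists N => m Nm; apply: (le_lt_trans (s_tail y N m Yy Nm)).
by rewrite mulrC -ltr_pdivlMr// hN.
Qed.

(** The expansion system consists of [x 0] and the successive differences, whose coordinates are the
    tails [b j] of the series of the [a y i]. *)
Lemma bounded_sums_iso_polyhedral (E : set (X -> R)) :
  infinite_dim Y ->
  (forall e, E e -> dual_elem e) -> iso_precisely_norming E ->
  (forall e, E e -> cvgn [series `|e (x n.+1 - x n)|]_n) ->
  iso_polyhedral Y.
Proof.
move=> Yinf Ed [C [C1 [EC [Elow Eatt]]]] Ex.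
have [sigma sigmaP] : exists sigma : X -> R,
    forall y, Y y -> s ^~ y @ \oo --> sigma y.
  have /choice[sigma h] : forall y, exists l : R, Y y -> s ^~ y @ \oo --> l.
    move=> y; have [Yy|nY] := pselect (Y y); last by exists 0.
    by have [l yl] := s_cvg y Yy; exists l.
  by exists sigma.
pose b j y := sigma y - s j y.
pose u j := if j is i.+1 then x i.+1 - x i else x 0%N.
have b_tail j y : Y y -> `|b j y| <= S * `|partial_sum x (a y) j - y|.
  by move=> Yy; apply: (lim_dist_le _ _ _ j _ (sigmaP y Yy)) => m; exact: s_tail.
have b_le j y : Y y -> `|b j y| <= S * ((K + 1) * `|y|).
  move=> Yy; apply: (le_trans (b_tail j y Yy)); rewrite ler_wpM2l ?(ltW S0)//.
  by apply: (le_trans (ler_normB _ _)); rewrite mulrDl mul1r lerD2r aK.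
have b_cvg0 y : Y y -> b ^~ y @ \oo --> (0 : R).
  move=> Yy; apply/cvgn_distP => eps eps0.
  have /cvgn_distP/(_ (eps / S))[|N hN] := a_cvg y Yy; first exact: divr_gt0.
  exists N => n Nn; rewrite subr0; apply: (le_lt_trans (b_tail n y Yy)).
  by rewrite mulrC -ltr_pdivlMr// hN.
(* Abel summation; the boundary term vanishes in the limit because [x] is bounded. *)
have QE y n : \sum_(0 <= i < n.+1) b i y *: u i =
    partial_sum x (a y) n + b n y *: x n.
  elim: n => [|n IH]; first by rewrite big_nat1 /partial_sum big_nil add0r.
  rewrite big_nat_recr//= IH /partial_sum big_nat_recr//= -!addrA; congr (_ + _).
  have -> : a y n = b n y - b n.+1 y by rewrite /b /s big_nat_recr//=; ring.
  by rewrite (scalerBl (b n y)) scalerBr [LHS]addrA addrAC.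
pose M := (S + S * D + 1) * (K + 1).
have SK (y : X) : 0 <= S * ((K + 1) * `|y|) by rewrite !mulr_ge0 ?addr_ge0// ltW.
have SD : 0 < S * D by exact: mulr_gt0.
have M0 : 0 < M by rewrite /M mulr_gt0 ?addr_gt0.
have y_ge0 (y : X) : 0 <= (K + 1) * `|y| by rewrite mulr_ge0 ?addr_ge0// ltW.
apply: (iso_polyhedral_of_expansion Y E b u C M) => //.
- move=> j t v w Yv Yw; rewrite /b (sL j)//.
  suff -> : sigma (t *: v + w) = t * sigma v + sigma w by rewrite mulrBr opprD addrACA.
  have hr : s ^~ (t *: v + w) @ \oo --> t * sigma v + sigma w.
    rewrite (_ : s ^~ (t *: v + w) = fun n => t * s n v + s n w); last first.
      by apply/funext => n; exact: sL.
    apply: cvgD; last exact: sigmaP.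
    by apply: cvgM; [exact: cvg_cst|exact: sigmaP].
  exact: (cvg_unique _ (sigmaP _ (proj2 YS t v w Yv Yw)) hr).
- move=> j y Yy; apply: (le_trans (b_le j y Yy)); rewrite /M -mulrA.
  by rewrite ler_wpM2r//; lra.
- move=> y [|m] Yy; first by rewrite big_nil normr0 mulr_ge0// ltW.
  rewrite QE; apply: (le_trans (ler_normD _ _)); rewrite normrZ.
  have h : `|b m y| * `|x m| <= S * ((K + 1) * `|y|) * D by apply: ler_pM => //; exact: b_le.
  have := aK y m Yy; have := SK y; have := normr_ge0 y.
  by move: h; rewrite /M; set z := `|y|; lra.
- move=> y Yy; apply/cvgn_distP => eps eps0.
  have /cvgn_distP/(_ (eps / 2))[|N hN] := a_cvg y Yy; first by rewrite divr_gt0.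
  have /cvgn_distP/(_ (eps / 2 / D))[|N' hN'] := b_cvg0 y Yy.
    by rewrite !divr_gt0.
  exists (maxn N N').+1 => -[//|n]; rewrite ltnS geq_max => /andP[Nn Nn'].
  rewrite QE addrAC; apply: (le_lt_trans (ler_normD _ _)); rewrite normrZ.
  have h : `|b n y| * `|x n| <= `|b n y| * D by rewrite ler_wpM2l.
  have := hN' n Nn'; rewrite subr0 ltr_pdivlMr// => h'.
  by have := hN n Nn; lra.
- move=> e Ee; have [k hk] := nonneg_series_bounded _ (fun=> normr_ge0 _) (Ex e Ee).
  apply: (nonneg_series_cvgn _ (`|e (x 0%N)| + k%:R)) => // -[|n].
    by rewrite big_nil addr_ge0.
  by rewrite big_nat_recl//= lerD2l hk.
Qed.

End BoundedSums.

(** * Extraction of the subsequence *)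

(* Abel summation against [1 / e (x i)]: the partial sums of [a i * e (x i)] are
   controlled by the basis constant, and [1 / e (x i)] has bounded variation
   because [e (x i)] does and stays away from 0. *)
Lemma sum_bound_of_separated {R : realType} (a t : nat -> R) (m n : nat)
    (B eta k : R) :
  (m <= n)%N -> 0 < eta ->
  (forall i, (m <= i <= n)%N -> eta <= `|t i|) ->
  (forall i, (m <= i <= n)%N -> `|\sum_(m <= l < i) a l * t l| <= B) ->
  \sum_(m <= i < n) `|t i.+1 - t i| <= k ->
  `|\sum_(m <= i < n) a i| <= B * (k / eta ^+ 2 + eta^-1).
Proof.
move=> mn eta0 teta tB tk.
have B0 : 0 <= B.
  by apply: le_trans (tB m _); rewrite ?leqnn.
(* What remains after removing the boundary term; its increments are the sums of [a l * t l] times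
   [1 / t j - 1 / t j.+1]. *)
pose W j := \sum_(m <= i < j) a i - (\sum_(m <= l < j) a l * t l) / t j.
have t0 i : (m <= i <= n)%N -> t i != 0.
  by move=> /teta ti; rewrite -normr_gt0; exact: lt_le_trans ti.
have WB j : (m <= j <= n)%N ->
    `|W j| <= B / eta ^+ 2 * \sum_(m <= i < j) `|t i.+1 - t i|.
  elim: j => [|j IH] mjn.
    by rewrite /W !big_geq ?mul0r ?subrr ?normr0 ?mulr0//; case/andP: mjn.
  have /andP[+ jn] := mjn; rewrite leq_eqVlt => /orP[/eqP mj|mj].
    by rewrite /W !big_geq -?mj ?mul0r ?subrr ?normr0 ?mulr0// mj.
  have mj' : (m <= j <= n)%N by rewrite -ltnS mj ltnW.
  have -> : W j.+1 = W j + (\sum_(m <= l < j.+1) a l * t l) *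
      (t j.+1 - t j) / (t j * t j.+1).
    rewrite /W !big_nat_recr//=; set s := \sum_(_ <= _ < _) a _.
    set s' := \sum_(_ <= _ < _) _ * _.
    by field; rewrite !t0.
  apply: (le_trans (ler_normD _ _)).
  rewrite [X in _ <= _ * X]big_nat_recr//= [leRHS]mulrDr; apply: lerD; first exact: IH.
  rewrite !normrM normfV normrM mulrAC ler_wpM2r//.
  apply: ler_pM; rewrite ?invr_ge0 ?mulr_ge0//; first exact: tB.
  rewrite lef_pV2 ?posrE ?exprn_gt0 ?mulr_gt0 ?normr_gt0 ?t0//.
  by rewrite expr2 ler_pM ?(ltW eta0)// teta.
have nn : (m <= n <= n)%N by rewrite mn leqnn.
have -> : \sum_(m <= i < n) a i = W n + (\sum_(m <= l < n) a l * t l) / t n.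
  by rewrite subrK.
apply: (le_trans (ler_normD _ _)); rewrite mulrDr; apply: lerD.
  apply: (le_trans (WB n nn)); rewrite mulrAC mulrA ler_wpM2r ?invr_ge0 ?exprn_ge0 ?(ltW eta0)//.
  by rewrite ler_wpM2l.
rewrite normrM normfV; apply: ler_pM => //; first exact: tB.
by rewrite lef_pV2 ?posrE ?normr_gt0 ?t0// teta.
Qed.

Lemma dist_le_variation {R : realType} (t : nat -> R) (m n : nat) :
  (m <= n)%N -> `|t n - t m| <= \sum_(m <= i < n) `|t i.+1 - t i|.
Proof. by move=> mn; rewrite -telescope_sumr// ler_norm_sum. Qed.

Lemma exists_increasing {P : nat -> nat -> nat -> Prop} :
  (forall j n, exists2 m, (n < m)%N & P j n m) ->
  exists phi : nat -> nat, (forall n, (phi n < phi n.+1)%N) /\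
    forall j, P j (phi j) (phi j.+1).
Proof.
move=> PP; have ex (p : nat * nat) : exists m, (p.2 < m)%N /\ P p.1 p.2 m.
  by have [m] := PP p.1 p.2; exists m.
have [h hP] := choice ex.
pose phi := fix phi n := if n is m.+1 then h (m, phi m) else 0%N.
by exists phi; split => n; have [] := hP (n, phi n).
Qed.

Lemma sum_half_expr_le2 {R : realType} n : \sum_(0 <= j < n) 2^-1 ^+ j <= 2 :> R.
Proof.
suff -> : \sum_(0 <= j < n) 2^-1 ^+ j = 2 - 2 * 2^-1 ^+ n :> R.
  by rewrite gerBl mulr_ge0// exprn_ge0 ?invr_ge0.
elim: n => [|n IH]; first by rewrite big_nil expr0 mulr1 subrr.
by rewrite big_nat_recr//= IH exprS; lra.
Qed.

(* Between [phi j] and [phi j.+1] the values of [t] drop below [2^-j], so the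
   variation over that block dominates [`|t (phi j)| - 2^-j]. *)
Lemma sum_subsequence_bound {R : realType} (t : nat -> R) (phi : nat -> nat)
    (k : nat) :
  (forall n, (phi n < phi n.+1)%N) ->
  (forall n, \sum_(0 <= i < n) `|t i.+1 - t i| <= k%:R) ->
  (forall j, (k <= j)%N ->
    exists2 i, (phi j <= i < phi j.+1)%N & `|t i| < 2^-1 ^+ j) ->
  forall n, \sum_(0 <= j < n) `|t (phi j)| <=
    \sum_(0 <= j < k) `|t (phi j)| + 2 + k%:R.
Proof.
move=> phi_lt tk tphi n.
pose V n := \sum_(0 <= i < n) `|t i.+1 - t i|.
have VB i j : (i <= j)%N -> \sum_(i <= l < j) `|t l.+1 - t l| = V j - V i.
  by move=> ij; rewrite /V [X in _ = X - _](big_cat_nat (n := i))//= [RHS]addrC addKr.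
have Vmono i j : (i <= j)%N -> V i <= V j.
  by move=> ij; rewrite -subr_ge0 -VB// sumr_ge0.
have [nk|/ltnW kn] := leqP n k.
  apply: (@le_trans _ _ (\sum_(0 <= j < k) `|t (phi j)|)).
    by rewrite [leRHS](big_cat_nat (n := n))//= lerDl sumr_ge0.
  by rewrite -addrA lerDl addr_ge0.
suff : \sum_(0 <= j < n) `|t (phi j)| <= \sum_(0 <= j < k) `|t (phi j)| +
    \sum_(k <= j < n) 2^-1 ^+ j + (V (phi n) - V (phi k)).
  move=> /le_trans; apply; have V0 : 0 <= V (phi k) by exact: sumr_ge0.
  have := tk (phi n); rewrite -/(V _) => Vn.
  have h2 := @sum_half_expr_le2 R n.
  have : \sum_(k <= j < n) 2^-1 ^+ j <= \sum_(0 <= j < n) 2^-1 ^+ j :> R.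
    rewrite [leRHS](big_cat_nat (n := k))//= lerDr.
    by apply: sumr_ge0 => i _; rewrite exprn_ge0 ?invr_ge0.
  by lra.
move: kn => /subnK <-; elim: (n - k)%N => [|i IH].
  by rewrite add0n [X in _ + X + _]big_geq// subrr !addr0.
rewrite addSn !big_nat_recr ?leq_addl//=.
have [l /andP[pl lp] tl] := tphi (i + k)%N (leq_addl _ _).
have := dist_le_variation t _ _ pl; rewrite VB// distrC.
have := lerB_dist (t (phi (i + k)%N)) (t l).
by have := Vmono _ _ (ltnW lp); lra.
Qed.

Theorem theorem3p2 (R : realType) (X : completeNormedModType R)
    (x : nat -> X) (E : set (X -> R)) :
  basic_seq x ->
  0 < inf [set `|x n| | n in [set: nat]] ->
  (forall e, E e -> dual_elem e) ->
  iso_precisely_norming E ->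
  (forall e, E e -> cvgn [series `|e (x n.+1 - x n)|]_n) ->
  exists phi : nat -> nat, (forall n, (phi n < phi n.+1)%N) /\
    iso_polyhedral (closed_span (range (x \o phi))).
Proof.
move=> x_basic; set theta := inf _ => theta0 Ed Eipn Ex.
have x_ge n : theta <= `|x n|.
  by apply: ge_inf; [exists 0 => _ [m _ <-]|exists n].
have [a [a_cvg a_uniq]] := exists_coordinates x x_basic.
have [K K0 aK] := basis_constant x theta theta0 x_ge a a_cvg a_uniq.
have [C [C1 [EC _]]] := Eipn; have C0 : 0 < C := lt_le_trans ltr01 C1.
pose subseq := subsequence_iso_polyhedral x theta theta0 x_ge a K K0 a_cvg a_uniq aK.
have eB e u v : E e -> e (u - v) = e u - e v.
  by move=> /Ed[eL _]; rewrite addrC -scaleN1r eL mulN1r addrC.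
have eZ e s u : E e -> e (s *: u) = s * e u.
  move=> Ee; have [eL _] := Ed e Ee; have e0 : e 0 = 0 by rewrite -(subrr 0) eB// subrr.
  by rewrite -[s *: u]addr0 eL e0 addr0.
have Evar e : E e -> exists k : nat,
    forall n, \sum_(0 <= i < n) `|e (x i.+1) - e (x i)| <= k%:R.
  move=> Ee; have [k hk] := nonneg_series_bounded _ (fun=> normr_ge0 _) (Ex e Ee).
  by exists k => n; under eq_bigr => i _ do rewrite -eB//.
have half_gt0 j : 0 < 2^-1 ^+ j :> R by rewrite exprn_gt0// invr_gt0.
have [[D xD]|unbdd] := pselect (exists D : R, forall n, `|x n| <= D); last first.
  have [|phi [phi_lt phi_big]] :=
      @exists_increasing (fun j _ m => 2 ^+ j.+1 <= `|x m|).
    move=> j n; apply: contrapT => none; apply: unbdd.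
    exists (2 ^+ j.+1 + \sum_(0 <= i < n.+1) `|x i|) => i.
    have [ni|ni] := ltnP n i; last first.
      rewrite ler_wpDl ?exprn_ge0// big_mkord.
      by rewrite (bigD1 (Ordinal (ni : (i < n.+1)%N)))//= lerDl sumr_ge0.
    rewrite ler_wpDr ?sumr_ge0// leNgt; apply/negP => xi.
    by apply: none; exists i => //; exact: ltW.
  (* The shift drops [phi 0], whose vector need not be large. *)
  exists (fun j => phi j.+1); split=> [n|]; first exact: phi_lt.
  apply: (subseq _ (fun n => phi_lt n.+1) E (fun j => 2^-1 ^+ j) 1) => //.
    move=> n; have := phi_big n; rewrite exprVn ler_pdivlMl ?exprn_gt0// mulr1.
    by apply: le_trans; rewrite exprS ler_peMl ?exprn_ge0// ler1n.
  move=> e Ee; have [k hk] := Evar e Ee.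
  (* Finite variation bounds [|e (x i)|] by [|e (x 0)| + k], and the weights [2^-j] have sums at
     most 2. *)
  apply: (nonneg_series_cvgn _ ((`|e (x 0%N)| + k%:R) * 2)) => // n.
  apply: (@le_trans _ _ (\sum_(0 <= j < n) (`|e (x 0%N)| + k%:R) * 2^-1 ^+ j)).
    apply: ler_sum => j _; rewrite eZ// normrM (gtr0_norm (half_gt0 j)) mulrC.
    rewrite ler_wpM2r ?(ltW (half_gt0 j))//.
    have := dist_le_variation (fun i => e (x i)) 0 (phi j.+1) (leq0n _).
    have := hk (phi j.+1); have := lerB_dist (e (x (phi j.+1))) (e (x 0%N)).
    by lra.
  by rewrite -mulr_sumr ler_wpM2l ?addr_ge0// sum_half_expr_le2.
pose vanish j n m := forall e, E e ->
  (forall n, \sum_(0 <= i < n) `|e (x i.+1) - e (x i)| <= j%:R) ->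
  exists2 i, (n <= i < m)%N & `|e (x i)| < 2^-1 ^+ j.
have [van|] := pselect (forall j n, exists2 m, (n < m)%N & vanish j n m).
  have [phi [phi_lt phiP]] := exists_increasing van.
  exists phi; split=> //.
  apply: (subseq _ phi_lt E (fun=> 1) theta) => //.
    by move=> n; rewrite mul1r.
  move=> e Ee; have [k hk] := Evar e Ee.
  apply: (nonneg_series_cvgn _ (\sum_(0 <= j < k) `|e (x (phi j))| + 2 + k%:R)) => // n.
  under eq_bigr => i _ do rewrite scale1r.
  apply: (sum_subsequence_bound (fun i => e (x i)) phi k phi_lt hk) => j kj.
  by apply: phiP => // m; apply: (le_trans (hk m)); rewrite ler_nat.
move=> /existsNP[k] /existsNP[n0] sep.
exists id; split=> //; rewrite (_ : x \o id = x)//.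
(* Negating [vanish] yields functionals of variation at most [k] that stay away from 0 on
   arbitrarily long intervals from [n0]; [e] may depend on [N], but the bounds do not. The whole
   sequence then serves. *)
have sepE N : exists2 e, E e & (forall n, \sum_(0 <= i < n) `|e (x i.+1) - e (x i)| <= k%:R) /\
    forall i, (n0 <= i < N)%N -> 2^-1 ^+ k <= `|e (x i)|.
  apply: contrapT => none; apply: sep; exists (maxn N n0.+1).
    by rewrite leq_max ltnSn orbT.
  move=> e Ee ek; apply: contrapT => no; apply: none; exists e => //; split=> // i iN.
  rewrite leNgt; apply/negP => ei; apply: no; exists i => //.
  by move: iN => /andP[-> iN]; rewrite leq_max iN.
have D0 : 0 < D by apply: lt_le_trans theta0 (le_trans (x_ge 0%N) (xD 0%N)).
pose A := 2 * K / theta; have A0 : 0 < A by rewrite divr_gt0// mulr_gt0.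
pose B := C * (2 * K); have B0 : 0 < B by rewrite !mulr_gt0.
pose r : R := k%:R / (2^-1 ^+ k) ^+ 2 + (2^-1 ^+ k)^-1.
have r0 : 0 < r by rewrite ltr_wpDl ?invr_gt0// divr_ge0 ?exprn_ge0 ?ltW.
have ab y i : closed_span (range x) y -> `|a y i| <= A * `|y|.
  exact: (coordinate_bound x theta theta0 x_ge a K aK).
have sumA y n : closed_span (range x) y ->
    \sum_(0 <= i < n) `|a y i| <= n%:R * A * `|y|.
  move=> Yy; apply: (@le_trans _ _ (\sum_(0 <= i < n) A * `|y|)).
    by apply: ler_sum => i _; exact: ab.
  by rewrite sumr_const_nat subn0 -[leLHS]mulr_natl mulrA.
(* The first [n0] coordinates are estimated one by one through [A], the others together by Abel
   summation with [eta = 2^-k], which gives [B * r]. *)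
apply: (bounded_sums_iso_polyhedral x a K K0 a_cvg a_uniq aK D D0 xD
  (n0%:R * A + B * r) _ _ E _ Ed Eipn Ex) => //.
- by rewrite ltr_wpDl ?mulr_gt0// mulr_ge0// ltW.
- move=> n y Yy; rewrite mulrDl.
  have [nn0|/ltnW n0n] := leqP n n0.
    apply: (le_trans (ler_norm_sum _ _ _)); apply: (le_trans (sumA y n Yy)).
    rewrite ler_wpDr//; first by apply: mulr_ge0 => //; apply/ltW/mulr_gt0.
    by apply: ler_wpM2r => //; apply: ler_wpM2r; [exact: ltW|rewrite ler_nat].
  rewrite (big_cat_nat (n := n0))//=; apply: (le_trans (ler_normD _ _)).
  apply: lerD; first exact: le_trans (ler_norm_sum _ _ _) (sumA y n0 Yy).
  (* The boundary term divides by [e (x n)], so the endpoint [n] must be included. *)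
  have [e Ee [ek e_ge]] := sepE n.+1.
  have eS i : e (partial_sum x (a y) i) = \sum_(0 <= l < i) a y l * e (x l).
    elim: i => [|i IH]; first by rewrite /partial_sum !big_nil -(subrr 0) eB// subrr.
    rewrite /partial_sum !big_nat_recr//= -IH.
    by have [eL _] := Ed e Ee; rewrite addrC eL addrC.
  apply: (@le_trans _ _ (B * `|y| * r)); last by rewrite mulrAC.
  apply: (sum_bound_of_separated (a y) (fun i => e (x i)) n0 n) => //.
  + move=> i /andP[n0i /leqW iN].
    have -> : \sum_(n0 <= l < i) a y l * e (x l) =
        e (partial_sum x (a y) i - partial_sum x (a y) n0).
      rewrite eB// !eS [X in _ = X - _](big_cat_nat (n := n0))//=.
      by rewrite [RHS]addrC addKr.
    apply: (le_trans (EC e Ee _)); rewrite /B -mulrA ler_wpM2l ?(ltW C0)//.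
    apply: (le_trans (ler_normB _ _)).
    by have := aK y i Yy; have := aK y n0 Yy; lra.
  + apply: le_trans (ek n); rewrite [leRHS](big_cat_nat (n := n0))//= lerDr.
    exact: sumr_ge0.
- exact: (infinite_dim_subsequence x a a_cvg a_uniq id (fun _ _ h => h)).
Qed.
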